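(* Stallings' group $S$ admits a linear isodiametric function. Indeed, its filling length function is linear (that is, $\simeq$-equivalent to $n\mapsto n$).
   Context: Notation: $x^y := y^{-1}xy$, $[x,y] := x^{-1}y^{-1}xy$. Stallings' group is $$S=\langle a,b,c,d,s \mid [a,c],\ [a,d],\ [b,c],\ [b,d],\ s^a=s^b=s^c=s^d\rangle,$$ where $s^a=s^b=s^c=s^d$ is shorthand for the six relations equating pairs among $s^a,s^b,s^c,s^d$. (It is isomorphic to the kernel of the homomorphism $F(\alpha,\beta)\times F(\gamma,\delta)\times F(\epsilon,\zeta)\to\mathbb{Z}=\langle t\rangle$ sending all six generators to $t$.) For a finite presentation $\langle\mathcal{A}\mid\mathcal{R}\rangle$: an isodiametric function is a function $f:\mathbb{N}\to\mathbb{N}$ such that every word of length at most $n$ representing the identity admits a van Kampen diagram over the presentation whose $1$-skeleton has diameter (in the combinatorial metric) at most $f(n)$. A null-sequence for a word $w$ representing the identity is a finite sequence of words from $w$ to the empty word, each obtained from the previous one by a free reduction ($\alpha xx^{-1}\beta\mapsto\alpha\beta$, $x\in\mathcal{A}^{\pm1}$), a free expansion (the inverse move), or an application of a relator ($\alpha u\beta\mapsto\alpha v\beta$ where a cyclic conjugate of $uv^{-1}$ lies in $\mathcal{R}^{\pm1}$). The filling length $\mathrm{FL}(w)$ is the minimum over all null-sequences for $w$ of the maximal length of a word in the sequence, and the filling length function is $\mathrm{FL}(n)=\max\{\mathrm{FL}(w)\mid w \text{ represents } 1,\ \ell(w)\le n\}$. For $f,g:\mathbb{N}\to\mathbb{N}$,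 $f\preceq g$ means there is $C>0$ such that $f(n)\le Cg(Cn+C)+Cn+C$ for all $n\in\mathbb{N}$; $f\simeq g$ means $f\preceq g$ and $g\preceq f$. *)

(* Defs.v *)
From HB Require Import structures.
From mathcomp Require Import all_boot.
From mathcomp Require Import boolp.

Set Implicit Arguments.
Unset Strict Implicit.
Unset Printing Implicit Defensive.

(* The letter (x, false) is the generator x, and (x, true) is x^-1. *)
Definition letter (A : Type) : Type := (A * bool)%type.
Definition word (A : Type) : Type := seq (letter A).

Definition linv (A : Type) (x : letter A) : letter A := (x.1, ~~ x.2).
Definition winv (A : Type) (w : word A) : word A := rev (map (@linv A) w).

(* x ^ y = y^-1 x y and [x, y] = x^-1 y^-1 x y, as unreduced words. *)
Definition wconj (A : Type) (x y : word A) : word A := winv y ++ x ++ y.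
Definition wcomm (A : Type) (x y : word A) : word A :=
  winv x ++ winv y ++ x ++ y.

Record presentation : Type := Presentation {
  gens : finType;
  rels : seq (word gens)
}.

Section Presentations.
Variable P : presentation.
Local Notation A := (gens P).

(* Equality in the group presented by P: the smallest congruence on words
   which identifies x x^-1 and the relators with the empty word. *)
Inductive group_eq : word A -> word A -> Prop :=
| group_eq_refl w : group_eq w w
| group_eq_sym v w : group_eq v w -> group_eq w v
| group_eq_trans u v w : group_eq u v -> group_eq v w -> group_eq u w
| group_eq_cat u u' v v' :
    group_eq u u' -> group_eq v v' -> group_eq (u ++ v) (u' ++ v')
| group_eq_cancel x : group_eq [:: x; linv x] [::]
| group_eq_rel r : r \in rels P -> group_eq r [::].

Definition represents_one (w : word A) : Prop := group_eq w [::].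

(* Some cyclic conjugate of w lies in R^{+1} or R^{-1}. *)
Definition cyclic_relator (w : word A) : Prop :=
  exists i : nat, rot i w \in rels P \/ winv (rot i w) \in rels P.

(** Van Kampen diagrams *)

(* A connected, simply connected, finite planar 2-complex is the complement of
   one open face in a cellular decomposition of the sphere; the latter is
   encoded as a combinatorial map.  Darts are oriented edges, [drev] reverses a
   dart, and [dnext] sends a dart to the one following it on the boundary of the
   face on its left, so that faces are orbits of [dnext] and the rotation at a
   vertex is [dnext \o drev].  The orbit listed by [dbound] is the removed outer
   face, and the other ones are the 2-cells.  [dEuler] says that V - E + F = 1,
   where F counts the 2-cells only.  A connected closed orientable surface of
   genus g with k faces removed has V - E + F = 2 - 2g - k; here k is 0 or 1,
   so [dEuler] forces genus 0 and k = 1.  The one-vertex complex, which has no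
   dart and an empty boundary circuit, also satisfies it. *)
Record diagram : Type := Diagram {
  dvert : finType;
  dart : finType;
  dorigin : dart -> dvert;
  drev : dart -> dart;
  dnext : dart -> dart;
  dlabel : dart -> letter A;
  dbound : seq dart;
  drev_invol : involutive drev;
  drev_neq : forall x, drev x != x;
  dnext_inj : injective dnext;
  dnext_origin : forall x, dorigin (dnext x) = dorigin (drev x);
  dvert_orbit : forall x y,
    dorigin x = dorigin y -> fconnect (dnext \o drev) x y;
  dbound_cycle : fcycle dnext dbound;
  dbound_uniq : uniq dbound;
  dconnected : forall u v : dvert,
    connect [rel u' v' | [exists x : dart,
               (dorigin x == u') && (dorigin (drev x) == v')]] u v;
  dEuler : #|dvert| + fcard dnext [pred x | x \notin dbound]
           = #|dart|./2 + 1;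
  dlabel_rev : forall x, dlabel (drev x) = linv (dlabel x);
  dlabel_cell : forall x, x \notin dbound ->
    cyclic_relator (map dlabel (orbit dnext x))
}.

Definition diagram_for (w : word A) (D : diagram) : Prop :=
  map (@dlabel D) (dbound D) = w.

Definition dadj (D : diagram) : rel (dvert D) :=
  [rel u v | [exists x : dart D, (dorigin x == u) && (dorigin (drev x) == v)]].

Definition diameter_le (D : diagram) (m : nat) : Prop :=
  forall u v : dvert D,
    exists p, [/\ path (@dadj D) u p, last u p = v & size p <= m].

Definition isodiametric_function (f : nat -> nat) : Prop :=
  forall (n : nat) (w : word A), size w <= n -> represents_one w ->
    exists D : diagram, diagram_for w D /\ diameter_le D (f n).

(** Filling length *)

Inductive null_move : word A -> word A -> Prop :=
| free_reduction al be x : null_move (al ++ [:: x; linv x] ++ be) (al ++ be)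
| free_expansion al be x : null_move (al ++ be) (al ++ [:: x; linv x] ++ be)
| apply_relator al be u v :
    cyclic_relator (u ++ winv v) -> null_move (al ++ u ++ be) (al ++ v ++ be).

(* The null-sequence is w :: ws. *)
Definition null_sequence (w : word A) (ws : seq (word A)) : Prop :=
  path [rel u v | `[< null_move u v >]] w ws /\ last w ws = [::].

Definition has_filling (w : word A) (m : nat) : Prop :=
  exists ws, null_sequence w ws /\ \max_(u <- w :: ws) size u = m.

(* The value 0 is a dummy, for words which have no null-sequence. *)
Definition FL_word (w : word A) : nat :=
  if pselect (exists m, `[< has_filling w m >]) is left exm
  then ex_minn exm else 0.

Definition FL (n : nat) : nat :=
  \max_(k < n.+1)
    \max_(w : k.-tuple (letter A) | `[< represents_one w >]) FL_word w.

End Presentations.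

Definition preceq (f g : nat -> nat) : Prop :=
  exists C : nat, 0 < C /\
    forall n, f n <= C * g (C * n + C) + C * n + C.

Definition simeq (f g : nat -> nat) : Prop := preceq f g /\ preceq g f.

Definition linear (f : nat -> nat) : Prop := simeq f (fun n => n).

(** Stallings' group *)

Inductive stallings_gen : Type := Sa | Sb | Sc | Sd | Ss.

Definition stallings_code (g : stallings_gen) : 'I_5 :=
  match g with
  | Sa => @Ordinal 5 0 isT
  | Sb => @Ordinal 5 1 isT
  | Sc => @Ordinal 5 2 isT
  | Sd => @Ordinal 5 3 isT
  | Ss => @Ordinal 5 4 isT
  end.

Definition stallings_decode (i : 'I_5) : stallings_gen :=
  nth Ss [:: Sa; Sb; Sc; Sd; Ss] i.

Lemma stallings_codeK : cancel stallings_code stallings_decode.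
Proof. by case. Qed.

HB.instance Definition _ := Finite.copy stallings_gen (can_type stallings_codeK).

Definition stallings : presentation :=
  let a : word stallings_gen := [:: (Sa, false)] in
  let b : word stallings_gen := [:: (Sb, false)] in
  let c : word stallings_gen := [:: (Sc, false)] in
  let d : word stallings_gen := [:: (Sd, false)] in
  let s : word stallings_gen := [:: (Ss, false)] in
  let eqn (u v : word stallings_gen) := u ++ winv v in
  @Presentation stallings_gen
    [:: wcomm a c; wcomm a d; wcomm b c; wcomm b d;
        eqn (wconj s a) (wconj s b); eqn (wconj s a) (wconj s c);
        eqn (wconj s a) (wconj s d); eqn (wconj s b) (wconj s c);
        eqn (wconj s b) (wconj s d); eqn (wconj s c) (wconj s d)].

(* Main.v *)
(* Call a rewriting step of a word collapsing if it is a free reduction or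
   replaces one letter by the rest of a relator.  A collapsing sequence from w to
   the empty word, read backwards, builds a van Kampen diagram for w by adding
   spikes and chords in the outer face.  Every vertex appears at some stage on
   the outer boundary, which always passes through the base vertex, so that the
   distances to the base vertex are bounded by the lengths of the words.

   Free expansions and insertions of relators are not collapsing, but if the
   Whitehead graph of the relators is connected, as it is for Stallings' group,
   then any nonempty word admits them as collapsing sequences, at the cost of a
   bounded increase of length.  Thus it suffices to find null-sequences of linear
   filling length.

   Since s commutes with all words of height (exponent sum) 0 in a, b, c, d, the
   conjugate of s by such a word depends on its height only, and
   S = F(s_i : i in Z) x| (F(a,b) x F(c,d)), where s_i = s^(a^i) and the action
   shifts the indices.  This gives a normal form of linear length, a traversal
   a^h1 s^e1 a^(h2-h1) s^e2 ... followed by reduced words in a, b and in c, d.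
   Reading w letter by letter, the normal form is updated in linear space; moving
   s across a word g in a, b of height h costs linear space because
   g s = c^h s c^-h g is obtained by sliding the letters of g one at a time past
   powers of c, with which they commute. *)
From mathcomp Require Import all_boot all_order all_algebra.
From mathcomp Require Import zify.
Require Import Defs.

Set Implicit Arguments.
Unset Strict Implicit.
Unset Printing Implicit Defensive.

(** * Formal inverses of words *)

Section Words.
Variable A : Type.
Implicit Types (x y : letter A) (u v w : word A).

Lemma linvK : involutive (@linv A).
Proof. by case=> g b; rewrite /linv /= negbK. Qed.

Lemma winv_cat u v : winv (u ++ v) = winv v ++ winv u.
Proof. by rewrite /winv map_cat rev_cat. Qed.

Lemma winv_cons x u : winv (x :: u) = winv u ++ [:: linv x].
Proof. by rewrite -cat1s winv_cat. Qed.

Lemma winvK : involutive (@winv A).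
Proof.
move=> w; rewrite /winv map_rev revK -map_comp.
by rewrite (eq_map (g := id)) ?map_id // => x; rewrite /= linvK.
Qed.

Lemma size_winv w : size (winv w) = size w.
Proof. by rewrite /winv size_rev size_map. Qed.

End Words.

Lemma rot_split (T : Type) (s : seq T) i :
  exists s1 s2, s = s1 ++ s2 /\ rot i s = s2 ++ s1.
Proof. by exists (take i s), (drop i s); rewrite cat_take_drop. Qed.

(** * Cyclic relators and collapsing sequences of bounded word length *)

Section Presentation.
Variable P : presentation.
Local Notation A := (gens P).
Implicit Types (x y : letter A) (u v w r al be : word A).

Lemma cyclic_relator_rotate u v :
  cyclic_relator (u ++ v) -> cyclic_relator (v ++ u).
Proof.
have main w : (exists i, rot i (u ++ v) = w) -> exists i, rot i (v ++ u) = w.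
  case=> i <-; case: (leqP i (size (u ++ v))) => [lei|/ltnW /rot_oversize ->].
    exists (if i + size v <= size (u ++ v) then i + size v
            else i + size v - size (u ++ v)).
    have <- : rot (size v) (v ++ u) = u ++ v by rewrite rot_size_cat.
    rewrite rot_add_mod ?size_rot ?size_cat ?leq_addr //.
    by move: lei; rewrite size_cat addnC.
  by exists (size v); rewrite rot_size_cat.
case=> i [rin|rin].
  by have [|j E] := main (rot i (u ++ v)); [exists i|exists j; left; rewrite E].
by have [|j E] := main (rot i (u ++ v)); [exists i|exists j; right; rewrite E].
Qed.

Lemma cyclic_relator_winv w : cyclic_relator w -> cyclic_relator (winv w).
Proof.
case=> i; have [s1 [s2 [-> ->]]] := rot_split w i => rin.
rewrite winv_cat.
apply: cyclic_relator_rotate; exists 0; rewrite rot0 -winv_cat winvK.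
by case: rin; [right|left].
Qed.

Lemma cyclic_relator_rels r : r \in rels P -> cyclic_relator r.
Proof. by move=> rin; exists 0; left; rewrite rot0. Qed.

(* The moves which collapse a van Kampen diagram: retract a spike, or push the
   boundary across a 2-cell from an edge of it. *)
Inductive collapse : word A -> word A -> Prop :=
| collapse_spike al be x : collapse (al ++ [:: x; linv x] ++ be) (al ++ be)
| collapse_cell al be y v :
    cyclic_relator (y :: winv v) -> collapse (al ++ y :: be) (al ++ v ++ be).

Inductive collapses (L : nat) : word A -> word A -> Prop :=
| collapses_refl w : size w <= L -> collapses L w w
| collapses_step u v w :
    size u <= L -> collapse u v -> collapses L v w -> collapses L u w.

Lemma collapses_trans L u v w :
  collapses L u v -> collapses L v w -> collapses L u w.
Proof.
by elim=> [//|u' v' w' hu uv _ IH] /IH; apply: collapses_step uv.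
Qed.

(** [K] bounds the excess over the length of the context and is independent of the context, so such
    a sequence can be used inside arbitrarily long words at constant cost. *)
Definition rewrites K u v := forall al be,
  collapses (size al + size be + K) (al ++ u ++ be) (al ++ v ++ be).

Lemma collapses_leq L M u v : L <= M -> collapses L u v -> collapses M u v.
Proof.
move=> LM; elim=> [w|u' v' w' hu uv _ IH].
  by move=> hw; apply: collapses_refl; lia.
by apply: collapses_step uv IH; lia.
Qed.

Lemma rewrites_leq K M u v : K <= M -> rewrites K u v -> rewrites M u v.
Proof. by move=> KM uv al be; apply: collapses_leq (uv al be); lia. Qed.

Lemma rewrites_trans K u v w :
  rewrites K u v -> rewrites K v w -> rewrites K u w.
Proof. by move=> uv vw al be; apply: collapses_trans (uv _ _) (vw _ _). Qed.

Lemma rewrites_ctx K al be u v :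
  rewrites K u v ->
  rewrites (K + size al + size be) (al ++ u ++ be) (al ++ v ++ be).
Proof.
move=> uv a b; have := uv (a ++ al) (be ++ b); rewrite -!catA.
by apply: collapses_leq; rewrite !size_cat; lia.
Qed.

Lemma rewrites_spike K x : 2 <= K -> rewrites K [:: x; linv x] [::].
Proof.
move=> K2 al be; apply: collapses_step (collapse_spike _ _ _) _.
  by rewrite !size_cat /=; lia.
by apply: collapses_refl; rewrite !size_cat /=; lia.
Qed.

Lemma rewrites_cell K y v :
  cyclic_relator (y :: winv v) -> (size v).+1 <= K -> rewrites K [:: y] v.
Proof.
move=> rel hK al be; apply: collapses_step (collapse_cell _ _ rel) _.
  by rewrite !size_cat /=; lia.
by apply: collapses_refl; rewrite !size_cat /=; lia.
Qed.

Lemma rewrites_winvl K u : 2 * size u <= K -> rewrites K (winv u ++ u) [::].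
Proof.
elim: u => [|x u IH] hK.
  by move=> al be; apply: collapses_refl; rewrite !size_cat /=; lia.
apply: (@rewrites_trans _ _ (winv u ++ u)); last by apply: IH; move: hK => /=; lia.
have := rewrites_ctx (winv u) u (@rewrites_spike 2 (linv x) isT).
rewrite linvK /= winv_cons -catA /=; apply: rewrites_leq.
by rewrite size_winv; move: hK => /=; lia.
Qed.

Lemma rewrites_relator K u v :
  cyclic_relator (u ++ winv v) -> 0 < size u ->
  2 * (size u + size v) <= K -> rewrites K u v.
Proof.
case: u => [//|y u] rel _ /= hK.
(* A cell move replaces a single letter, so only the first letter [y] is pushed across the 2-cell;
   the remaining [u] then cancels against [winv u] by spikes. *)
apply: (@rewrites_trans _ _ (v ++ winv u ++ u)).
  have: rewrites (size v + size u).+1 [:: y] (v ++ winv u).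
    by apply: rewrites_cell; rewrite ?winv_cat ?winvK // size_cat size_winv.
  move/(@rewrites_ctx _ [::] u); rewrite /= -catA; apply: rewrites_leq; lia.
have := rewrites_ctx v [::] (@rewrites_winvl _ u (leqnn _)).
by rewrite !cats0; apply: rewrites_leq => /=; lia.
Qed.

(** * Free expansions along paths in the Whitehead graph *)

Definition expands x y := exists K, rewrites K [:: y] [:: x; linv x; y].

(* The expansion relation contains the edges of the Whitehead graph. *)
Lemma expands_relator x y z q : cyclic_relator [:: linv x, y, z & q] -> expands x y.
Proof.
set q' := z :: q => rel; exists (2 * (size q + 4)).
apply: (@rewrites_trans _ _ (x :: winv q')).
  apply: rewrites_cell; last by rewrite /= size_winv /=; lia.
  rewrite winv_cons winvK -cat_cons.
  exact: (@cyclic_relator_rotate [:: linv x] (y :: q')).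
have rel' : cyclic_relator (winv q' ++ winv [:: linv x; y]).
  by rewrite -winv_cat; apply: cyclic_relator_winv.
have := @rewrites_relator _ _ _ rel'; rewrite size_winv /= => /(_ _ isT (leqnn _)).
move/(@rewrites_ctx _ [:: x] [::]); rewrite !cats0; apply: rewrites_leq.
by rewrite /=; lia.
Qed.

(** Expand to [z z^-1 y], then to [x x^-1 z z^-1 y], and cancel [z z^-1]. Thus edges of the
    Whitehead graph can be chained into paths. *)
Lemma expands_trans z x y : expands x z -> expands z y -> expands x y.
Proof.
case=> K xz [M zy]; exists (K + M + 8).
apply: (@rewrites_trans _ _ [:: z; linv z; y]).
  by apply: rewrites_leq zy; lia.
apply: (@rewrites_trans _ _ [:: x; linv x; z; linv z; y]).
  by have /= := rewrites_ctx [::] [:: linv z; y] xz; apply: rewrites_leq; lia.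
have /= := rewrites_ctx [:: x; linv x] [:: y] (@rewrites_spike 2 z isT).
by apply: rewrites_leq; lia.
Qed.

Lemma uniform_bound (T : finType) (Q : T -> nat -> Prop) :
  (forall t K M, K <= M -> Q t K -> Q t M) ->
  (forall t, exists K, Q t K) -> exists K, forall t, Q t K.
Proof.
move=> monoQ exQ.
suff [K hK] : exists K, forall t, t \in enum T -> Q t K.
  by exists K => t; apply: hK; rewrite mem_enum.
elim: (enum T) => [|t s [K hK]]; first by exists 0.
have [M hM] := exQ t; exists (K + M) => t'; rewrite inE => /predU1P[->|t's].
  by apply: monoQ hM; lia.
by apply: monoQ (hK _ t's); lia.
Qed.

(** * Derivations of equality through words of bounded length *)

Definition trivial_piece r := (exists x, r = [:: x; linv x]) \/ r \in rels P.

Inductive elementary : word A -> word A -> Prop :=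
| elementary_del al be r : trivial_piece r -> elementary (al ++ r ++ be) (al ++ be)
| elementary_ins al be r : trivial_piece r -> elementary (al ++ be) (al ++ r ++ be).

(** The reflexive case puts no bound on its word, so a bound on the initial word has to be supplied
    separately wherever it matters. *)
Inductive eq_within (L : nat) : word A -> word A -> Prop :=
| eq_within_refl w : eq_within L w w
| eq_within_step u v w : size u <= L -> size v <= L -> elementary u v ->
    eq_within L v w -> eq_within L u w.

Lemma eq_within_trans L v u w :
  eq_within L u v -> eq_within L v w -> eq_within L u w.
Proof. by elim=> [//|u' v' w' hu hv uv _ IH] /IH; apply: eq_within_step uv. Qed.

Lemma eq_within_sym L u v : eq_within L u v -> eq_within L v u.
Proof.
elim=> [w|u' v' w' hu hv uv _ IH]; first exact: eq_within_refl.
apply: eq_within_trans IH _; apply: eq_within_step (eq_within_refl _ _) => //.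
by case: uv => al be r hr; constructor.
Qed.

Lemma elementary_ctx al be u v :
  elementary u v -> elementary (al ++ u ++ be) (al ++ v ++ be).
Proof.
by case=> a b r hr; [have := @elementary_del (al ++ a) (b ++ be) r hr
  |have := @elementary_ins (al ++ a) (b ++ be) r hr]; rewrite -!catA.
Qed.

Lemma eq_within_ctx L M al be u v :
  size al + L + size be <= M ->
  eq_within L u v -> eq_within M (al ++ u ++ be) (al ++ v ++ be).
Proof.
move=> LM; elim=> [w|u' v' w' hu hv uv _ IH]; first exact: eq_within_refl.
by apply: eq_within_step (elementary_ctx al be uv) IH; rewrite !size_cat; lia.
Qed.

Lemma eq_within_leq L M u v : L <= M -> eq_within L u v -> eq_within M u v.
Proof.
by move=> LM /(@eq_within_ctx L M [::] [::]); rewrite /= !cats0; apply; lia.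
Qed.

Lemma eq_within_cancel L x : 2 <= L -> eq_within L [:: x; linv x] [::].
Proof.
move=> hL; apply: eq_within_step (eq_within_refl _ _) => //.
by apply: (@elementary_del [::] [::] [:: x; linv x]); left; exists x.
Qed.

(** The bound depends on [u] and [v] without any control; this serves only for finitely many fixed
    short identities. *)
Lemma group_eq_within u v : group_eq u v -> exists L, eq_within L u v.
Proof.
elim=> {u v} [w|u v _ [L uv]|u v w _ [L uv] _ [M vw]
  |u u' v v' _ [L uu] _ [M vv]|x|r rin].
- by exists 0; apply: eq_within_refl.
- by exists L; apply: eq_within_sym.
- by exists (L + M); apply: (@eq_within_trans _ v);
    [apply: eq_within_leq uv|apply: eq_within_leq vw]; lia.
- exists (L + M + size u' + size v); apply: (@eq_within_trans _ (u' ++ v)).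
    by apply: (@eq_within_ctx L _ [::] v) => //=; lia.
  by have := @eq_within_ctx M (L + M + size u' + size v) u' [::] _ _ _ vv;
    rewrite !cats0; apply; rewrite /=; lia.
- by exists 2; apply: eq_within_cancel.
- exists (size r); apply: eq_within_step (eq_within_refl _ _) => //.
  by have := @elementary_del [::] [::] r (or_intror rin); rewrite /= !cats0.
Qed.

Lemma group_eq_ctx al be u v :
  group_eq u v -> group_eq (al ++ u ++ be) (al ++ v ++ be).
Proof.
move=> uv; apply: group_eq_cat (group_eq_refl _) _.
exact: group_eq_cat uv (group_eq_refl _).
Qed.

Lemma group_eq_winv u : group_eq (u ++ winv u) [::].
Proof.
elim: u => [|x u IH]; first exact: group_eq_refl.
have := group_eq_ctx [:: x] [:: linv x] IH.
rewrite winv_cons -catA /= => H; apply: group_eq_trans H _.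
exact: group_eq_cancel.
Qed.

Lemma group_eq_cyclic_relator u v : cyclic_relator (u ++ winv v) -> group_eq u v.
Proof.
have rel1 w : cyclic_relator w -> group_eq w [::].
  case=> i; have [s1 [s2 [-> ->]]] := rot_split w i => rin.
  have rel21 : group_eq (s2 ++ s1) [::].
    case: rin => [/group_eq_rel //|/group_eq_rel/group_eq_sym rinv].
    have := group_eq_ctx (s2 ++ s1) [::] rinv; rewrite !cats0 => H.
    by apply: group_eq_trans H (group_eq_winv _).
  (* Undo the rotation: [s1 s2 = s1 (s2 s1) s1^-1 = s1 s1^-1]. *)
  have := group_eq_ctx (s1 ++ s2) [::] (group_eq_sym (group_eq_winv s1)).
  rewrite !cats0 => H; apply: group_eq_trans H _.
  have := group_eq_ctx s1 (winv s1) rel21; rewrite -!catA => H.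
  exact: group_eq_trans H (group_eq_winv _).
move=> /rel1 uv.
have := group_eq_ctx u [::] (group_eq_sym (group_eq_winv (winv v))).
rewrite !cats0 winvK => H; apply: group_eq_trans H _.
by have := group_eq_ctx [::] v uv; rewrite /= -catA.
Qed.

(** * From bounded derivations to collapsing sequences *)

Lemma rewrites_expand_all :
  (forall x y, expands x y) ->
  exists K, forall x y, rewrites K [:: y] [:: x; linv x; y].
Proof.
move=> exxy; have [|[x y]|K hK] := @uniform_bound (letter A * letter A)%type
  (fun p K => rewrites K [:: p.2] [:: p.1; linv p.1; p.2]).
- by move=> t K M; apply: rewrites_leq.
- exact: exxy.
- by exists K => x y; apply: (hK (x, y)).
Qed.

Section Expansion.
Variable K : nat.
Hypothesis expand : forall x y, rewrites K [:: y] [:: x; linv x; y].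

Lemma collapses_expand L x al be :
  0 < size (al ++ be) -> size (al ++ be) + K + 8 <= L ->
  collapses L (al ++ be) (al ++ [:: x; linv x] ++ be).
Proof.
case: be => [|y be] ht hL; last first.
  have := expand x y al be; apply: collapses_leq.
  by move: hL; rewrite size_cat /=; lia.
case/lastP: al ht hL => [//|al y] _; rewrite cats0 size_rcons -cats1 => hL.
(* At the end of the word no letter follows the insertion point, so one is created: [y], [y y^-1 y],
   [y x x^-1 y^-1 y], [y x x^-1]. *)
have yy := expand y y; have := expand x (linv y).
move/(rewrites_ctx [:: y] [:: y]) => /= xy.
have sp := rewrites_ctx [:: y; x; linv x] [::] (@rewrites_spike 2 (linv y) isT).
rewrite linvK /= in sp.
have all : rewrites (K + 7) [:: y] [:: y; x; linv x].
  apply: (@rewrites_trans _ _ [:: y; linv y; y]).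
    by apply: rewrites_leq yy; lia.
  apply: (rewrites_trans (rewrites_leq _ xy)); first by lia.
  by apply: rewrites_leq sp; lia.
by have := all al [::]; rewrite /= -!catA /=; apply: collapses_leq; rewrite /=; lia.
Qed.

Lemma collapses_expand_word L u al be :
  0 < size (al ++ be) -> size (al ++ be) + 2 * size u + K + 8 <= L ->
  collapses L (al ++ be) (al ++ u ++ winv u ++ be).
Proof.
elim: u al be => [|x u IH] al be ht hL.
  by apply: collapses_refl; rewrite /=; lia.
apply: (@collapses_trans _ _ (al ++ [:: x; linv x] ++ be)).
  by apply: collapses_expand => //; move: hL => /=; lia.
have := IH (al ++ [:: x]) (linv x :: be).
rewrite winv_cons -!catA /=; apply; rewrite !size_cat /=; first by lia.
by move: hL; rewrite size_cat /=; lia.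
Qed.

Lemma collapses_elementary L u v M :
  (forall r, r \in rels P -> size r <= M) ->
  0 < size u -> size u <= L -> size v <= L -> elementary u v ->
  collapses (L + 4 * M + K + 8) u v.
Proof.
move=> hM hu uL vL uv; case: uv hu uL vL => al be r [[x ->]|rin] hu uL vL.
- apply: collapses_step (collapse_spike _ _ _) _; first by lia.
  by apply: collapses_refl; lia.
- case: r rin hu uL vL => [|y r] rin hu uL vL.
    by apply: collapses_refl; move: uL => /=; lia.
  have := @rewrites_relator (2 * M) (y :: r) [::].
  rewrite cats0 => /(_ (cyclic_relator_rels rin) isT); rewrite addn0 => H.
  have := H _ al be; rewrite leq_mul2l /= => /(_ (hM _ rin)).
  by apply: collapses_leq; move: vL; rewrite !size_cat; lia.
- by apply: collapses_expand => //; lia.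
- apply: (@collapses_trans _ _ (al ++ r ++ winv r ++ be)).
    by apply: collapses_expand_word => //; have := hM _ rin; lia.
  case: r rin hu uL vL => [|y r] rin hu uL vL.
    by apply: collapses_refl; move: uL => /=; lia.
  have := @rewrites_relator (2 * M) (winv (y :: r)) [::].
  rewrite cats0 size_winv.
  move=> /(_ (cyclic_relator_winv (cyclic_relator_rels rin)) isT).
  rewrite addn0 => H.
  have := H _ (al ++ y :: r) be; rewrite leq_mul2l /= => /(_ (hM _ rin)).
  rewrite -!catA; apply: collapses_leq; move: vL; rewrite !size_cat /=; lia.
Qed.

End Expansion.

(* The empty word is the only one at which nothing can be expanded, and a path
   to the empty word may be stopped at the first occurrence of it. *)
Lemma collapses_of_eq_within :
  (forall x y, expands x y) ->
  exists K, forall L w,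
    size w <= L -> eq_within L w [::] -> collapses (L + K) w [::].
Proof.
case/rewrites_expand_all => K hK.
have [M hM] : exists M, forall r, r \in rels P -> size r <= M.
  elim: (rels P) => [|r s [M hM]]; first by exists 0.
  exists (size r + M) => r'; rewrite inE => /predU1P[->|/hM]; lia.
exists (4 * M + K + 8) => L w.
move E: [::] => e hw H; elim: H E hw => {w e} [w <- _|u v w hu hv uv _ IH E _].
  exact: collapses_refl.
case: (posnP (size u)) => [/size0nil ->|u0].
  by rewrite -E; apply: collapses_refl.
apply: collapses_trans (IH E hv).
rewrite (_ : _ + _ = L + 4 * M + K + 8); last by lia.
exact: (collapses_elementary hK hM u0 hu hv uv).
Qed.

(** * Filling length bounds from collapsing sequences *)

Lemma null_move_collapse u v : collapse u v -> null_move u v.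
Proof.
case=> [al be x|al be y w rel]; first exact: free_reduction.
exact: (@apply_relator _ al be [:: y] w).
Qed.

Lemma FL_word_collapses L w : collapses L w [::] -> FL_word w <= L.
Proof.
move=> H; have [ws [[pws lws] mws]] : exists ws, null_sequence w ws /\
    \max_(u <- w :: ws) size u <= L.
  move E: [::] H => e H.
  elim: H E => {w e} [w hw <-|u v w hu uv _ IH E].
    by exists [::]; split; [|rewrite big_seq1].
  have [ws [[pws lws] mws]] := IH E; exists (v :: ws); split.
    split=> //=; rewrite pws andbT; apply/boolp.asboolP.
    exact: null_move_collapse.
  by rewrite big_cons geq_max hu.
rewrite /FL_word; case: boolp.pselect => [exm|//].
case: ex_minnP => m _ /(_ (\max_(u <- w :: ws) size u)) leqm.
by apply: leq_trans mws; apply: leqm; apply/boolp.asboolP; exists ws.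
Qed.

End Presentation.

(** * From collapsing sequences to van Kampen diagrams *)

Lemma fcard_uniq (T : finType) (f : T -> T) (s : seq T) :
  uniq s -> fcard f s = count (roots (frel f)) s.
Proof.
move=> us; rewrite -size_filter -(card_uniqP (filter_uniq _ us)).
by apply: eq_card => x; rewrite !inE mem_filter.
Qed.

(** Each nonempty cycle of [f] in the list is a whole orbit, so it contributes exactly one root. *)
Lemma fcard_flatten (T : finType) (f : T -> T) (cs : seq (seq T)) :
  injective f -> uniq (flatten cs) -> [::] \notin cs ->
  {in cs, forall c, fcycle f c} -> fcard f (flatten cs) = size cs.
Proof.
move=> injf us nocs fcs; rewrite fcard_uniq // count_flatten.
elim: cs us nocs fcs => [//|c cs IH] /=; rewrite cat_uniq => /and3P[uc _ ucs].
rewrite inE negb_or => /andP[c0 nocs] fcs.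
rewrite IH //; last by move=> d dcs; apply: fcs; rewrite inE dcs orbT.
rewrite -fcard_uniq //; case: c c0 uc fcs => [//|x c] _ uc fcs.
rewrite -(@eq_n_comp_r _ _ (fconnect f x)).
  by rewrite n_comp_connect //; apply: fconnect_sym.
by move=> y; apply: (fconnect_cycle (fcs _ (mem_head _ _))); apply: mem_head.
Qed.

Definition rev_dart (x : nat * bool) := (x.1, ~~ x.2).

Lemma rev_dartK : involutive rev_dart.
Proof. by case=> i b; rewrite /rev_dart negbK. Qed.

(* [f] assigns to each dart the value at its origin. *)
Fixpoint walk (T : Type) (f : nat * bool -> T) (p q : T) s : Prop :=
  if s is x :: s' then f x = p /\ walk f (f (rev_dart x)) q s' else p = q.

Section Walk.
Variable T : Type.
Implicit Types (f : nat * bool -> T).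

Lemma walk_cat f (p q : T) s t :
  walk f p q (s ++ t) <-> exists r, walk f p r s /\ walk f r q t.
Proof.
elim: s p => [|x s IH] p /=.
  by split=> [w|[r [-> //]]]; exists p.
split=> [[-> /IH[r [ws wt]]]|[r [[-> ws] wt]]]; first by exists r.
by split=> //; apply/IH; exists r.
Qed.

Lemma walk_rev f (p q : T) s : walk f p q s -> walk f q p (map rev_dart (rev s)).
Proof.
elim: s p => [p ->//|x s IH] p /= [fx /IH ws].
rewrite rev_cons map_rcons -cats1; apply/walk_cat.
by exists (f (rev_dart x)); split=> //=; rewrite rev_dartK fx.
Qed.

(** In the universality proofs this determines the value of [f] at the ends of a new edge: [f]
    factors through the old origins, and the end of an [f]-walk is the image of the end of the
    underlying walk. *)
Lemma walk_comp (U : Type) (h : nat * bool -> U) f (g : U -> T) n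
    (p q : U) (p' q' : T) s :
  (forall x, x.1 < n -> f x = g (h x)) -> (forall x, x \in s -> x.1 < n) ->
  walk h p q s -> walk f p' q' s -> p' = g p -> q' = g q.
Proof.
move=> fgh; elim: s p p' => [|x s IH] p p' ns /=; first by move=> -> -> ->.
case=> hx wh [fx wf] _; apply: IH wh wf _.
  by move=> y ys; apply: ns; rewrite inE ys orbT.
by apply: fgh; have := ns x; rewrite mem_head; apply.
Qed.

Lemma eq_walk f g n (p q : T) s :
  (forall x, x.1 < n -> f x = g x) -> (forall x, x \in s -> x.1 < n) ->
  walk f p q s -> walk g p q s.
Proof.
move=> fg; elim: s p => [//|x s IH] p ns /=.
have nx : x.1 < n by apply: ns; rewrite mem_head.
rewrite !fg // => -[-> ws]; split=> //; apply: IH ws => y ys.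
by apply: ns; rewrite inE ys orbT.
Qed.

End Walk.

Lemma walk_cycle (T : eqType) (f : nat * bool -> T) c :
  (exists p, walk f p p c) <-> cycle [rel x y | f (rev_dart x) == f y] c.
Proof.
have main p q x s : walk f p q (x :: s) <->
    [/\ f x = p, path [rel x y | f (rev_dart x) == f y] x s
      & f (rev_dart (last x s)) = q].
  elim: s p x => [|y s IH] p x; first by split=> [[]|[]].
  rewrite [walk _ _ _ _]/= -/(walk f (f (rev_dart x)) q (y :: s)).
  split=> [[-> /IH[E ps lst]]|[-> /= /andP[/eqP E ps] lst]].
    by split=> //=; rewrite E eqxx.
  by split=> //; apply/IH.
(* Any value serves as base point of the empty circuit. *)
case: c => [|x c]; first by split=> // _; exists (f (0, false)).
rewrite /= rcons_path /=; split=> [[p /main[<- -> ->]]|/andP[ps /eqP E]].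
  by rewrite eqxx.
by exists (f x); apply/main.
Qed.

(** * Planar maps grown in the outer face *)

Section PlanarMap.
Variable P : presentation.
Local Notation A := (gens P).

(* Edge i has the darts (i, false) and (i, true), and 0 is the base vertex.
   Instead of rotations at the vertices, [pm_universal] says that any function
   which is compatible with all the faces factors through the origin map, so
   that vertices are as little identified as the faces allow. *)
Record planar_map (L : nat) (w : word A) : Type := PlanarMap {
  pm_edges : nat;
  pm_verts : nat;
  pm_org : nat * bool -> nat;
  pm_label : nat * bool -> letter A;
  pm_outer : seq (nat * bool);
  pm_inner : seq (seq (nat * bool));
  pm_size : size (pm_outer ++ flatten pm_inner) = pm_edges.*2;
  pm_uniq : uniq (pm_outer ++ flatten pm_inner);
  pm_mem : forall x : nat * bool, (x \in pm_outer ++ flatten pm_inner) = (x.1 < pm_edges);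
  pm_verts_gt0 : 0 < pm_verts;
  pm_org_lt : forall x, x.1 < pm_edges -> pm_org x < pm_verts;
  pm_label_rev : forall x, x.1 < pm_edges ->
    pm_label (rev_dart x) = linv (pm_label x);
  pm_outer_closed : walk pm_org 0 0 pm_outer;
  pm_inner_closed : forall c, c \in pm_inner -> exists p, walk pm_org p p c;
  pm_inner_nonempty : [::] \notin pm_inner;
  pm_universal : forall (f : nat * bool -> bool) p, walk f p p pm_outer ->
    (forall c, c \in pm_inner -> exists q, walk f q q c) ->
    exists g : nat -> bool, g 0 = p /\
      forall x, x.1 < pm_edges -> f x = g (pm_org x);
  pm_reach : forall v, v < pm_verts -> exists s,
    [/\ forall x, x \in s -> x.1 < pm_edges, walk pm_org 0 v s & size s <= L];
  pm_euler : pm_verts + size pm_inner = pm_edges + 1;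
  pm_inner_label : forall c, c \in pm_inner ->
    cyclic_relator (map pm_label c);
  pm_outer_label : map pm_label pm_outer = w
}.

Lemma planar_map_nil L (x0 : letter A) : planar_map L [::].
Proof.
apply: (@PlanarMap L [::] 0 1 (fun=> 0) (fun=> x0) [::] [::]) => //.
  by move=> f p _ _; exists (fun=> p).
by case=> // _; exists [::].
Qed.

Definition add_edge (T : Type) (f : nat * bool -> T) n (p q : T) x :=
  if x.1 == n then if x.2 then q else p else f x.

Lemma add_edge_old T (f : nat * bool -> T) n p q x :
  x.1 < n -> add_edge f n p q x = f x.
Proof. by rewrite /add_edge; case: eqP => // ->; rewrite ltnn. Qed.

Lemma walk_add_edge T (f : nat * bool -> T) n a b p q s :
  (forall x, x \in s -> x.1 < n) ->
  walk f p q s -> walk (add_edge f n a b) p q s.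
Proof. by apply: eq_walk => x xn; rewrite add_edge_old. Qed.

Lemma walk_lt (f : nat * bool -> nat) n k p q s :
  (forall x, x.1 < n -> f x < k) -> (forall x, x \in s -> x.1 < n) ->
  p < k -> walk f p q s -> q < k.
Proof.
move=> fk; elim: s p => [|x s IH] p ns pk /=; first by move <-.
case=> _; apply: IH.
  by move=> y ys; apply: ns; rewrite inE ys orbT.
by apply: fk; exact: (ns x (mem_head _ _)).
Qed.

Lemma ltnS_case n (x : nat * bool) : x.1 < n.+1 ->
  [\/ x.1 < n, x = (n, false) | x = (n, true)].
Proof.
rewrite ltnS leq_eqVlt => /orP[/eqP E|xn]; last by constructor 1.
by case: x E => i [] /= ->; [constructor 3|constructor 2].
Qed.

Lemma map_eq_cat (T U : Type) (f : T -> U) s u v : map f s = u ++ v ->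
  exists s1 s2, [/\ s = s1 ++ s2, map f s1 = u & map f s2 = v].
Proof.
move=> E; exists (take (size u) s), (drop (size u) s).
by rewrite cat_take_drop map_take map_drop E take_size_cat ?drop_size_cat.
Qed.

Lemma new_darts n (s t : seq (nat * bool)) :
  perm_eq t [:: (n, false), (n, true) & s] ->
  size s = n.*2 -> uniq s -> (forall x, (x \in s) = (x.1 < n)) ->
  [/\ size t = n.+1.*2, uniq t & forall x, (x \in t) = (x.1 < n.+1)].
Proof.
move=> pst sz us ms; rewrite (perm_uniq pst) (perm_size pst) /= sz; split=> //.
  by rewrite !inE !ms us xpair_eqE /= !ltnn !andbF.
move=> x; rewrite (perm_mem pst) !inE ms ltnS [x.1 <= n]leq_eqVlt.
by case: x => i []; rewrite !xpair_eqE /=; case: (i == n); case: (i < n).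
Qed.

(** A pendant edge [n] with a new end vertex [k] is attached at the vertex [p] where the boundary
    passes from [al] to [be]. *)
Lemma planar_map_spike L al be x :
  size (al ++ [:: x; linv x] ++ be) <= L ->
  planar_map L (al ++ be) -> inhabited (planar_map L (al ++ [:: x; linv x] ++ be)).
Proof.
move=> hL [n k org lab out inn sz us ms k0 orgk labr outc innc inn0 univ reach eul
  innl outl].
have [a [b [E la lb]]] := map_eq_cat outl.
move: outc; rewrite E => /walk_cat[p [wa wb]].
have na y : y \in a -> y.1 < n by rewrite -ms E !mem_cat => ->.
have nb y : y \in b -> y.1 < n by rewrite -ms E !mem_cat => ->; rewrite orbT.
have ni c y : c \in inn -> y \in c -> y.1 < n.
  by move=> cin yc; rewrite -ms mem_cat; apply/orP; right; apply/flattenP; exists c.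
have pk : p < k by apply: (walk_lt orgk na k0 wa).
have kn0 : (0 == k) = false by apply/negbTE; rewrite neq_ltn k0.
have ne (T : Type) (f : nat * bool -> T) q r :
    (add_edge f n q r (n, false) = q) * (add_edge f n q r (n, true) = r).
  by rewrite /add_edge /= eqxx.
set e := (n, false); set e' := (n, true).
have pdarts : perm_eq ((a ++ [:: e; e'] ++ b) ++ flatten inn)
    [:: e, e' & out ++ flatten inn].
  by rewrite E; apply/permP => q; rewrite /= !count_cat /=; lia.
have [sz' us' ms'] := new_darts pdarts sz us ms.
split; apply: (@PlanarMap L _ n.+1 k.+1 (add_edge org n p k)
  (add_edge lab n x (linv x)) (a ++ [:: e; e'] ++ b) inn) => //.
- move=> y /ltnS_case[yn|->|->]; rewrite ?ne ?ltnS // ?(ltnW pk) //.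
  by rewrite add_edge_old // ltnW // orgk.
- move=> y /ltnS_case[yn|->|->]; rewrite ?ne ?linvK //.
  by rewrite !add_edge_old // labr.
- apply/walk_cat; exists p; split; first exact: walk_add_edge.
  by rewrite /= !ne; split=> //; split=> //; apply: walk_add_edge.
- move=> c cin; have [q wq] := innc _ cin; exists q; apply: walk_add_edge => //.
  by move=> y; apply: ni.
- move=> f q /walk_cat[r [fa /= [fe [_ fb]]]] finn.
  (* The spike returns to the value it started from, so removing it leaves an [f]-closed outer
     circuit; the value at [k] is then free to be [f e']. *)
  have [|g [g0 gP]] := univ f q _ finn.
    by rewrite E; apply/walk_cat; exists r; split=> //; rewrite -fe.
  exists (fun v => if v == k then f e' else g v); rewrite kn0; split=> //.
  have rp := walk_comp gP na wa fa (esym g0).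
  move=> y /ltnS_case[yn|->|->]; rewrite ?ne ?eqxx //.
    by rewrite add_edge_old // ltn_eqF ?orgk ?gP.
  by rewrite ltn_eqF // -rp.
- move=> v; rewrite ltnS leq_eqVlt => /predU1P[->|/reach[s [sn ws sL]]].
    (* The new vertex is reached along the outer boundary, and this is where the word length bounds
       the distance to the base vertex. *)
    exists (a ++ [:: e]); split.
    + by move=> y; rewrite mem_cat inE => /orP[/na/ltnW //|/eqP->] /=.
    + by apply/walk_cat; exists p; rewrite /= !ne; split=> //; apply: walk_add_edge.
    + by move: hL; rewrite -la !size_cat size_map /=; lia.
  by exists s; split=> //; [move=> y /sn/ltnW|apply: walk_add_edge].
- by rewrite addSn eul addSn.
- move=> c cin; rewrite (_ : map _ c = map lab c); first exact: innl.
  by apply/eq_in_map => y yc; rewrite add_edge_old // (ni c).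
- rewrite !map_cat /= !ne -la -lb; congr (_ ++ [:: _, _ & _]);
    by apply/eq_in_map => y yc; rewrite add_edge_old ?(na _ yc) ?(nb _ yc).
Qed.

(** A chord is drawn in the outer face between the ends of the boundary path [m] labelled [v]. It
    cuts off one 2-cell and adds no vertex, so distances and Euler characteristic are preserved. *)
Lemma planar_map_cell L al be y v :
  cyclic_relator (y :: winv v) ->
  planar_map L (al ++ v ++ be) -> inhabited (planar_map L (al ++ y :: be)).
Proof.
move=> rel [n k org lab out inn sz us ms k0 orgk labr outc innc inn0 univ reach eul
  innl outl].
have [a [c [E la lc]]] := map_eq_cat outl.
have [m [b [Ec lm lb]]] := map_eq_cat lc; rewrite {c lc}Ec in E.
move: outc; rewrite E => /walk_cat[p [wa /walk_cat[q [wm wb]]]].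
have na z : z \in a -> z.1 < n by rewrite -ms E !mem_cat => ->.
have nm z : z \in m -> z.1 < n by rewrite -ms E !mem_cat => ->; rewrite !orbT.
have nb z : z \in b -> z.1 < n by rewrite -ms E !mem_cat => ->; rewrite !orbT.
have ni c z : c \in inn -> z \in c -> z.1 < n.
  by move=> cin yc; rewrite -ms mem_cat; apply/orP; right; apply/flattenP; exists c.
have pk : p < k by apply: (walk_lt orgk na k0 wa).
have qk : q < k by apply: (walk_lt orgk nm pk wm).
have ne (T : Type) (f : nat * bool -> T) p' r :
    (add_edge f n p' r (n, false) = p') * (add_edge f n p' r (n, true) = r).
  by rewrite /add_edge /= eqxx.
set e := (n, false); set e' := (n, true).
have pdarts : perm_eq ((a ++ e :: b) ++ flatten ((m ++ [:: e']) :: inn))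
    [:: e, e' & out ++ flatten inn].
  by rewrite E; apply/permP => r; rewrite /= !(count_cat, count_flatten) /=; lia.
have [sz' us' ms'] := new_darts pdarts sz us ms.
split; apply: (@PlanarMap L _ n.+1 k (add_edge org n p q)
  (add_edge lab n y (linv y)) (a ++ e :: b) ((m ++ [:: e']) :: inn)) => //.
- move=> z /ltnS_case[zn|->|->]; rewrite ?ne //.
  by rewrite add_edge_old // orgk.
- move=> z /ltnS_case[zn|->|->]; rewrite ?ne ?linvK //.
  by rewrite !add_edge_old // labr.
- apply/walk_cat; exists p; split; first exact: walk_add_edge.
  by rewrite /= !ne; split=> //; apply: walk_add_edge.
- move=> c; rewrite inE => /predU1P[->|cin].
    exists p; apply/walk_cat; exists q; rewrite /= !ne; split=> //.
    exact: walk_add_edge.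
  have [r wr] := innc _ cin; exists r; apply: walk_add_edge => //.
  by move=> z; apply: ni.
- by rewrite inE negb_or inn0 andbT; case: (m).
- move=> f r /walk_cat[r1 [fa /= [fe fb]]] finn.
  have [r2 /walk_cat[r3 [fm /= [fe' fr2]]]] := finn _ (mem_head _ _).
  (* Closedness around the new cell makes [m] and the chord have the same end values under [f], so
     [m] may replace the chord in the outer circuit. *)
  have [||g [g0 gP]] := univ f r.
  + rewrite E; apply/walk_cat; exists r1; split=> //.
    apply/walk_cat; exists r3; split; first by rewrite -fe fr2.
    by rewrite -fe'.
  + by move=> c cin; apply: finn; rewrite inE cin orbT.
  exists g; split=> //.
  have rp := walk_comp gP na wa fa (esym g0).
  have fm' : walk f r1 r3 m by rewrite -fe fr2.
  have rq := walk_comp gP nm wm fm' rp.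
  move=> z /ltnS_case[zn|->|->]; rewrite ?ne ?fe ?fe' //.
  by rewrite add_edge_old // gP.
- move=> t /reach[s [sn ws sL]].
  by exists s; split=> //; [move=> z /sn/ltnW|apply: walk_add_edge].
- by rewrite /= addnS eul addSn.
- move=> c; rewrite inE => /predU1P[->|cin].
    (* The new cell reads [v y^-1], the inverse of [y v^-1]. *)
    rewrite map_cat /= ne (_ : map _ m = v).
      by have := cyclic_relator_winv rel; rewrite winv_cons winvK.
    by rewrite -lm; apply/eq_in_map => z zc; rewrite add_edge_old // nm.
  rewrite (_ : map _ c = map lab c); first exact: innl.
  by apply/eq_in_map => z zc; rewrite add_edge_old // (ni c).
- rewrite !map_cat /= !ne -la -lb; congr (_ ++ _ :: _);
    by apply/eq_in_map => z zc; rewrite add_edge_old ?(na _ zc) ?(nb _ zc).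
Qed.

Lemma planar_map_collapses L (x0 : letter A) w :
  collapses L w [::] -> inhabited (planar_map L w).
Proof.
move E: [::] => e H; elim: H E => {w e} [w _ <-|u v w hu uv _ IH E].
  by split; apply: planar_map_nil.
case: (IH E) => pm; case: uv pm hu {IH} => [al be x|al be y v' rel] pm hu.
  exact: planar_map_spike.
exact: planar_map_cell rel pm.
Qed.

(** * The van Kampen diagram of a planar map *)

Section Diagram.
Variables (L : nat) (w : word A) (M : planar_map L w).
Local Notation darts := (pm_outer M ++ flatten (pm_inner M)).
Local Notation faces := (pm_outer M :: pm_inner M).
Local Notation D := (seq_sub darts).

Lemma pm_dart_lt (x : D) : (val x).1 < pm_edges M.
Proof. by rewrite -pm_mem (valP x). Qed.

Definition pm_rev (x : D) : D :=
  SeqSub (etrans (pm_mem M (rev_dart (val x))) (pm_dart_lt x)).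

Definition pm_origin (x : D) : 'I_(pm_verts M) :=
  Ordinal (pm_org_lt (pm_dart_lt x)).

Definition pm_face x := nth [::] faces (find (fun c => x \in c) faces).

Lemma pm_faceE c x : c \in faces -> x \in c -> pm_face x = c.
Proof.
rewrite /pm_face; have: uniq (flatten faces) := pm_uniq M.
elim: faces => [//|d cs IH] /=; rewrite cat_uniq => /and3P[_ /hasPn dcs ucs].
rewrite inE => /predU1P[->|ccs] xc; first by rewrite xc.
have /negbTE-> : x \notin d by apply: dcs; apply/flattenP; exists c.
exact: IH.
Qed.

Lemma pm_faceP x : x \in darts -> pm_face x \in faces /\ x \in pm_face x.
Proof.
by case/(@flattenP _ faces) => c cf xc; rewrite (pm_faceE cf xc).
Qed.

Lemma pm_face_uniq c : c \in faces -> uniq c.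
Proof.
have: uniq (flatten faces) := pm_uniq M.
elim: faces => [//|d cs IH] /=; rewrite cat_uniq => /and3P[ud _ ucs].
by rewrite inE => /predU1P[->//|]; apply: IH.
Qed.

Lemma pm_face_darts c x : c \in faces -> x \in c -> x \in darts.
Proof. by move=> cf xc; apply/(@flattenP _ faces); exists c. Qed.

Lemma pm_next_darts (x : D) : next (pm_face (val x)) (val x) \in darts.
Proof.
have [cf xc] := pm_faceP (valP x).
by apply: pm_face_darts cf _; rewrite mem_next.
Qed.

Definition pm_next (x : D) : D := SeqSub (pm_next_darts x).

Lemma pm_next_inj : injective pm_next.
Proof.
move=> x y /(congr1 val) /= E; apply: val_inj.
have [cf xc] := pm_faceP (valP x); have [df yd] := pm_faceP (valP y).
have nx : next (pm_face (val x)) (val x) \in pm_face (val x) by rewrite mem_next.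
have ny : next (pm_face (val y)) (val y) \in pm_face (val y) by rewrite mem_next.
have Ef : pm_face (val x) = pm_face (val y).
  by rewrite -(pm_faceE cf nx) E (pm_faceE df ny).
by rewrite -(prev_next (pm_face_uniq cf) (val x)) E Ef prev_next // pm_face_uniq.
Qed.

Definition pm_sub (c : seq (nat * bool)) : seq D := pmap insub c.

Lemma map_pm_sub c : {subset c <= darts} -> map val (pm_sub c) = c.
Proof.
move=> cd; rewrite /pm_sub pmap_filter; last exact: insubK.
by apply/all_filterP/allP => x xc; rewrite isSome_insub; apply: cd.
Qed.

Lemma map_face_sub c : c \in faces -> map val (pm_sub c) = c.
Proof. by move=> cf; apply: map_pm_sub => x; apply: pm_face_darts. Qed.

Lemma mem_pm_sub c x : (x \in pm_sub c) = (val x \in c).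
Proof. by rewrite mem_pmap_sub. Qed.

Lemma fcycle_face c : c \in faces -> fcycle pm_next (pm_sub c).
Proof.
move=> cf; have := cycle_next (pm_face_uniq cf).
rewrite -{2}(map_face_sub cf) cycle_map.
apply: (@sub_in_cycle _ [in pm_sub c]); last by apply/allP.
move=> x y; rewrite !mem_pm_sub => xc yc /= /eqP E.
by apply/eqP/val_inj; rewrite /= (pm_faceE cf xc).
Qed.

Lemma faces_closed c : c \in faces -> exists p, walk (pm_org M) p p c.
Proof.
rewrite inE => /predU1P[->|]; last exact: pm_inner_closed.
by exists 0; apply: pm_outer_closed.
Qed.

Lemma pm_next_origin x : pm_origin (pm_next x) = pm_origin (pm_rev x).
Proof.
apply: val_inj => /=; have [cf xc] := pm_faceP (valP x).
by have /walk_cycle/next_cycle/(_ xc)/eqP := faces_closed cf.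
Qed.

Lemma pm_rev_involutive : involutive pm_rev.
Proof. by move=> x; apply: val_inj; apply: rev_dartK. Qed.

Lemma pm_rev_neq x : pm_rev x != x.
Proof.
rewrite -val_eqE /= /rev_dart -pair_eqE /=.
by case: (val x) => i []; rewrite andbF.
Qed.

(** Apply universality to the indicator function of the orbit of [x] under [sg]. Since [pm_next u]
    is the image of [pm_rev u] under [sg], this function is compatible with every face, hence
    factors through origins, and a dart with the origin of [x] lies in the orbit. *)
Lemma pm_vert_orbit x y :
  pm_origin x = pm_origin y -> fconnect (pm_next \o pm_rev) x y.
Proof.
set sg := pm_next \o pm_rev => /(congr1 val) /= Exy.
have sg_inj : injective sg.
  exact: inj_comp pm_next_inj (inv_inj pm_rev_involutive).
pose f z := oapp (fconnect sg x) false (insub z).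
have fE (z : D) : f (val z) = fconnect sg x z by rewrite /f valK.
have fP c : c \in faces -> exists p, walk f p p c.
  move=> cf; apply/walk_cycle; rewrite -(map_face_sub cf) cycle_map.
  apply: sub_cycle (fcycle_face cf) => u v /= /eqP <-; apply/eqP.
  rewrite -[rev_dart _]/(val (pm_rev u)) -[ssval (pm_next u)]/(val (pm_next u)) !fE.
  by rewrite (same_fconnect1_r sg_inj) /sg /= pm_rev_involutive.
have [p fp] := fP _ (mem_head _ _).
have [|g [_ gP]] := pm_universal fp.
  by move=> c cin; apply: fP; rewrite inE cin orbT.
by rewrite -fE gP ?pm_dart_lt // -Exy -gP ?pm_dart_lt // fE connect0.
Qed.

(** The path goes through the base vertex, which doubles the bound. *)
Lemma pm_reach_both (u v : 'I_(pm_verts M)) : exists s,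
  [/\ {subset s <= darts}, walk (pm_org M) u v s & size s <= L.*2].
Proof.
have [s [sd ws sL]] := pm_reach (ltn_ord u).
have [t [td wt tL]] := pm_reach (ltn_ord v).
exists (map rev_dart (rev s) ++ t); split.
- move=> x; rewrite mem_cat pm_mem => /orP[/mapP[y]|/td //].
  by rewrite mem_rev => /sd ? ->.
- by apply/walk_cat; exists 0; split=> //; apply: walk_rev.
- by rewrite size_cat size_map size_rev -addnn leq_add.
Qed.

Definition pm_adj : rel 'I_(pm_verts M) := [rel u v | [exists x : D,
  (pm_origin x == u) && (pm_origin (pm_rev x) == v)]].

Lemma pm_adj_path s (u v : 'I_(pm_verts M)) :
  {subset s <= darts} -> walk (pm_org M) u v s ->
  exists p, [/\ path pm_adj u p, last u p = v & size p = size s].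
Proof.
elim: s u => [|x s IH] u sd /=; first by move/val_inj => <-; exists [::].
have xd : x \in darts by apply/sd/mem_head.
pose x' : D := SeqSub xd; case=> xu ws.
have [|//|p [pp lp sp]] := IH (pm_origin (pm_rev x')).
  by move=> y ys; apply: sd; rewrite inE ys orbT.
exists (pm_origin (pm_rev x') :: p); rewrite /= sp pp lp; split=> //.
by rewrite andbT; apply/existsP; exists x'; rewrite eqxx andbT -val_eqE /= xu.
Qed.

Lemma pm_dist (u v : 'I_(pm_verts M)) :
  exists p, [/\ path pm_adj u p, last u p = v & size p <= L.*2].
Proof.
have [s [sd ws sL]] := pm_reach_both u v.
have [p [pp lp sp]] := pm_adj_path sd ws.
by exists p; rewrite sp.
Qed.

Lemma pm_connected u v : connect pm_adj u v.
Proof. by have [p [pp <- _]] := pm_dist u v; apply/connectP; exists p. Qed.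

Lemma pm_sub_uniq c : uniq c -> uniq (pm_sub c).
Proof. by move=> uc; apply: pmap_sub_uniq. Qed.

Lemma flatten_pm_sub cs : flatten (map pm_sub cs) = pm_sub (flatten cs).
Proof. by elim: cs => [//|c cs IH] /=; rewrite IH /pm_sub pmap_cat. Qed.

Lemma mem_outer_sub (x : D) :
  (x \notin pm_sub (pm_outer M)) = (x \in flatten (map pm_sub (pm_inner M))).
Proof.
rewrite flatten_pm_sub !mem_pm_sub.
have := pm_uniq M; rewrite cat_uniq => /and3P[_ /hasPn dis _].
have := valP x; rewrite /= mem_cat.
case: (boolP (val x \in pm_outer M)) => [xo _|//]; apply/esym/negbTE.
by apply/negP => /dis; rewrite /= xo.
Qed.

Lemma pm_fcard :
  fcard pm_next [pred x | x \notin pm_sub (pm_outer M)] = size (pm_inner M).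
Proof.
rewrite (@eq_n_comp_r _ _ _ (mem (flatten (map pm_sub (pm_inner M))))); last first.
  by move=> x; rewrite inE mem_outer_sub.
rewrite fcard_flatten ?size_map //; first exact: pm_next_inj.
- rewrite flatten_pm_sub pm_sub_uniq //.
  by have := pm_uniq M; rewrite cat_uniq => /and3P[].
- apply/mapP => -[c cin Ec]; have := pm_inner_nonempty M.
  have /map_face_sub : c \in faces by rewrite inE cin orbT.
  by rewrite -Ec /= => ->; rewrite cin.
- move=> _ /mapP[c cin ->]; apply: fcycle_face.
  by rewrite inE cin orbT.
Qed.

Lemma pm_euler_fcard :
  #|'I_(pm_verts M)| + fcard pm_next [pred x | x \notin pm_sub (pm_outer M)]
  = #|{: D}|./2 + 1.
Proof.
by rewrite pm_fcard card_ord card_seq_sub ?pm_uniq // pm_size doubleK pm_euler.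
Qed.

Lemma pm_dlabel_rev x :
  pm_label M (val (pm_rev x)) = linv (pm_label M (val x)).
Proof. exact: pm_label_rev (pm_dart_lt x). Qed.

Lemma pm_cell x : x \notin pm_sub (pm_outer M) ->
  cyclic_relator (map (fun x => pm_label M (val x)) (orbit pm_next x)).
Proof.
rewrite mem_outer_sub => /flattenP[_ /mapP[c cin ->] xc].
have cf : c \in faces by rewrite inE cin orbT.
have [i ->] := orbit_rot_cycle (fcycle_face cf) (pm_sub_uniq (pm_face_uniq cf)) xc.
rewrite map_rot (map_comp (pm_label M)) map_face_sub //.
have := pm_inner_label cin; have [s1 [s2 [-> ->]]] := rot_split (map (pm_label M) c) i.
exact: cyclic_relator_rotate.
Qed.

Definition pm_diagram : diagram P := Diagram pm_rev_involutive pm_rev_neq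
  pm_next_inj pm_next_origin pm_vert_orbit (fcycle_face (mem_head _ _))
  (pm_sub_uniq (pm_face_uniq (mem_head _ _))) pm_connected pm_euler_fcard
  pm_dlabel_rev pm_cell.

Lemma pm_diagram_for : diagram_for w pm_diagram.
Proof.
rewrite /diagram_for /= (map_comp (pm_label M)) map_face_sub ?mem_head //.
exact: pm_outer_label.
Qed.

Lemma pm_diameter : diameter_le pm_diagram L.*2.
Proof. exact: pm_dist. Qed.

End Diagram.

Lemma diagram_collapses L (x0 : letter A) w : collapses L w [::] ->
  exists D : diagram P, diagram_for w D /\ diameter_le D L.*2.
Proof.
case/(planar_map_collapses x0) => M; exists (pm_diagram M).
by split; [apply: pm_diagram_for|apply: pm_diameter].
Qed.

End PlanarMap.

(** * Stallings' group *)

Local Notation letterS := (letter stallings_gen).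
Local Notation wordS := (word stallings_gen).

(** The relators have length 4 or 6, so six rotations exhaust the cyclic conjugates. *)
Definition relator_check (w : wordS) : bool :=
  has (fun i => (rot i w \in rels stallings) || (winv (rot i w) \in rels stallings))
    (iota 0 6).

Lemma relator_checkP (w : wordS) :
  relator_check w -> cyclic_relator (P := stallings) w.
Proof. by case/hasP => i _ /orP; exists i. Qed.

(** * Connectedness of the Whitehead graph by computation *)

Definition stallings_letters : seq letterS :=
  [seq (g, b) | g <- [:: Sa; Sb; Sc; Sd; Ss], b <- [:: false; true]].

Lemma mem_stallings_letters x : x \in stallings_letters.
Proof. by case: x => -[] []. Qed.

Lemma letter_ind2 (Q : letterS -> letterS -> bool) :
  all (fun x => all (Q x) stallings_letters) stallings_letters ->
  forall x y, Q x y.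
Proof.
by move=> /allP H x y; apply: (allP (H x _)); apply: mem_stallings_letters.
Qed.

(** An edge comes from a cyclic subword [x^-1 y] of a relator or of its inverse. *)
Definition whitehead_edge (x y : letterS) : bool :=
  has (fun r => has (fun i => (2 < size r) && ([:: linv x; y] == take 2 (rot i r)))
    (iota 0 6)) (rels stallings ++ map (@winv _) (rels stallings)).

Lemma whitehead_expands x y : whitehead_edge x y -> expands (P := stallings) x y.
Proof.
case/hasP => r rin /hasP[i _ /andP[r2 /eqP E]].
have rel : cyclic_relator (P := stallings) (rot i r).
  have [s1 [s2 [Er ->]]] := rot_split r i; apply: cyclic_relator_rotate.
  move: rin; rewrite -Er mem_cat => /orP[|/mapP[r' rin ->]].
    exact: (@cyclic_relator_rels stallings).
  exact/cyclic_relator_winv/(@cyclic_relator_rels stallings).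
have sz : size (rot i r) = size r by rewrite size_rot.
case: (rot i r) sz rel E => [|x' [|y' [|z q]]] //= sz; rewrite -?sz // in r2 *.
by move=> rel [Ex Ey]; apply: (@expands_relator stallings x y z q); rewrite Ex Ey.
Qed.

(** Any two of the ten letters, equal or not, are joined by a path of length one or two in the
    Whitehead graph. *)
Lemma stallings_expands x y : expands (P := stallings) x y.
Proof.
have /orP[/whitehead_expands //|/hasP[z _ /andP[xz zy]]] :
    whitehead_edge x y ||
    has (fun z => whitehead_edge x z && whitehead_edge z y) stallings_letters.
  by move: x y; apply: letter_ind2; vm_compute.
exact: expands_trans (whitehead_expands xz) (whitehead_expands zy).
Qed.

(** * Commutation and sliding identities *)

Definition ab_letter (x : letterS) := (x.1 == Sa) || (x.1 == Sb).
Definition cd_letter (x : letterS) := (x.1 == Sc) || (x.1 == Sd).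
Definition opposite (x y : letterS) :=
  ab_letter x && cd_letter y || cd_letter x && ab_letter y.

Local Notation group_eqS := (@group_eq stallings).

Lemma group_eq_check (u v : wordS) : relator_check (u ++ winv v) -> group_eqS u v.
Proof. by move/relator_checkP; apply: group_eq_cyclic_relator. Qed.

Lemma group_eq_commute x z : opposite x z -> group_eqS [:: x; z] [:: z; x].
Proof.
move=> oxz; apply: group_eq_check; move: oxz; apply/implyP.
by move: x z; apply: letter_ind2; vm_compute.
Qed.

(** For inverse letters this is a conjugation relator up to rotation and inversion; for positive
    letters it is deduced from that case and commutation. *)
Lemma group_eq_slide x z e : opposite x z -> x.2 = z.2 ->
  group_eqS [:: x; (Ss, e)] [:: z; (Ss, e); linv z; x].
Proof.
case: x z => g [] [h []] // ogh _.
  apply: group_eq_check.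
  by case: g h ogh => -[] //; case: e; vm_compute.
set t := (Ss, e); set x := (g, false); set z := (h, false).
(* With this identity, [x t = z x z^-1 t = z x (z^-1 t z x^-1) x z^-1 = z x x^-1 t x z^-1 = z t x
   z^-1 = z t z^-1 x]. *)
have neg : group_eqS [:: linv x; t] [:: linv z; t; z; linv x].
  apply: group_eq_check; rewrite /t.
  by case: g h @x @z ogh => -[] //; case: (e); vm_compute.
have xz : group_eqS [:: linv z; x] [:: x; linv z].
  by apply: group_eq_check; case: g h @x @z ogh {neg} => -[] //; vm_compute.
have cz : group_eqS [::] [:: z; linv z] by apply/group_eq_sym/group_eq_cancel.
have cx : group_eqS [:: x; linv x] [::] by apply: group_eq_cancel.
have ctx := @group_eq_ctx stallings.
have cz' : group_eqS [::] [:: z; linv x; x; linv z].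
  apply: group_eq_trans cz _; apply: (ctx [:: z] [:: linv z] [::] [:: linv x; x]).
  by apply/group_eq_sym; have := @group_eq_cancel stallings (linv x); rewrite linvK.
apply: group_eq_trans (ctx [::] [:: x; t] _ _ cz) _ => /=.
apply: group_eq_trans (ctx [:: z] [:: t] _ _ xz) _ => /=.
apply: group_eq_trans (ctx [:: z; x; linv z; t] [::] _ _ cz') _ => /=.
apply: group_eq_trans (ctx [:: z; x] [:: x; linv z] _ _ (group_eq_sym neg)) _ => /=.
apply: group_eq_trans (ctx [:: z] [:: t; x; linv z] _ _ cx) _ => /=.
exact: (ctx [:: z; t] [::] _ _ (group_eq_sym xz)).
Qed.

Local Notation eq_withinS := (@eq_within stallings).

Lemma eq_within_at L M al be (u v w w' : wordS) :
  eq_withinS L u v -> w = al ++ u ++ be -> w' = al ++ v ++ be ->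
  size al + L + size be <= M -> eq_withinS M w w'.
Proof. by move=> uv -> -> LM; apply: (@eq_within_ctx stallings _ _ _ _ _ _ LM uv). Qed.

(** * Heights and signed powers of a generator *)

Definition ht (x : letterS) : int :=
  if x.1 == Ss then 0%R else if x.2 then (-1)%R else 1%R.
Definition wht (w : wordS) : int := foldr (fun x h => (ht x + h)%R) 0%R w.

Definition zpow (z : stallings_gen) (h : int) : wordS :=
  nseq `|h|%N (z, (h < 0)%R).

Lemma size_zpow z h : size (zpow z h) = `|h|%N.
Proof. exact: size_nseq. Qed.

(** With truncated subtraction at most one of the two powers on the right is nonempty, which covers
    both signs of [m - n] at once. *)
Lemma eq_within_nseq L m n (x : letterS) : m + n <= L ->
  eq_withinS L (nseq m x ++ nseq n (linv x)) (nseq (m - n) x ++ nseq (n - m) (linv x)).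
Proof.
elim: m n => [|m IH] n mnL; first by rewrite subn0; apply: eq_within_refl.
case: n mnL => [|n] mnL; first by rewrite subn0; apply: eq_within_refl.
rewrite !subSS; apply: (@eq_within_trans stallings _ _ _ _ _ (IH _ _)); last by lia.
apply: (@eq_within_at 2 _ (nseq m x) (nseq n (linv x)) [:: x; linv x] [::]) => //.
- exact: eq_within_cancel.
- by rewrite -(addn1 m) nseqD -catA.
- by rewrite !size_nseq; lia.
Qed.

Lemma zpowD L z h k : `|h|%N + `|k|%N <= L ->
  eq_withinS L (zpow z h ++ zpow z k) (zpow z (h + k)%R).
Proof.
move=> hkL; rewrite /zpow.
case: (boolP (h < 0)%R) (boolP (k < 0)%R) => h0 [] k0.
- rewrite -nseqD; have -> : (h + k < 0)%R by lia.
  have -> : `|(h + k)%R|%N = `|h|%N + `|k|%N by lia.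
  exact: eq_within_refl.
- have := @eq_within_nseq L `|h|%N `|k|%N (z, true) hkL; rewrite /linv /=.
  case: (boolP (h + k < 0)%R) => hk0.
    have -> : `|k|%N - `|h|%N = 0 by lia.
    by rewrite cats0; have -> : `|h|%N - `|k|%N = `|(h + k)%R|%N by lia.
  have -> : `|h|%N - `|k|%N = 0 by lia.
  by have -> : `|k|%N - `|h|%N = `|(h + k)%R|%N by lia.
- have := @eq_within_nseq L `|h|%N `|k|%N (z, false) hkL; rewrite /linv /=.
  case: (boolP (h + k < 0)%R) => hk0.
    have -> : `|h|%N - `|k|%N = 0 by lia.
    by have -> : `|k|%N - `|h|%N = `|(h + k)%R|%N by lia.
  have -> : `|k|%N - `|h|%N = 0 by lia.
  by rewrite cats0; have -> : `|h|%N - `|k|%N = `|(h + k)%R|%N by lia.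
- rewrite -nseqD; have -> : (h + k < 0)%R = false by lia.
  have -> : `|(h + k)%R|%N = `|h|%N + `|k|%N by lia.
  exact: eq_within_refl.
Qed.

Lemma wht_cat u v : wht (u ++ v) = (wht u + wht v)%R.
Proof. by elim: u => [|x u IH] /=; [lia|rewrite IH; lia]. Qed.

Lemma wht_rev u : wht (rev u) = wht u.
Proof. by elim: u => [//|x u IH]; rewrite rev_cons -cats1 wht_cat IH /=; lia. Qed.

Lemma absz_ht x : `|ht x|%N <= 1.
Proof. by rewrite /ht; case: ifP => // _; case: ifP. Qed.

Lemma absz_wht w : `|wht w|%N <= size w.
Proof. by elim: w => [//|x w IH] /=; have := absz_ht x; lia. Qed.

Lemma wht_nseq z n e : z != Ss ->
  wht (nseq n (z, e)) = (if e then - (Posz n) else Posz n)%R.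
Proof.
move=> /negbTE zs; elim: n => [|n IH] /=; first by case: e.
by rewrite IH /ht /= zs; case: e {IH}; lia.
Qed.

Lemma wht_zpow z h : z != Ss -> wht (zpow z h) = h.
Proof. by move=> zs; rewrite wht_nseq //; case: (boolP (h < 0)%R); lia. Qed.

Lemma zpow_ht z x : x.1 != Ss -> zpow z (ht x) = [:: (z, x.2)].
Proof. by move=> /negbTE xs; rewrite /ht xs; case: x.2. Qed.

Lemma zpow_htN z x : x.1 != Ss -> zpow z (- ht x)%R = [:: (z, ~~ x.2)].
Proof. by move=> /negbTE xs; rewrite /ht xs; case: x.2. Qed.

Lemma opposite_neq x z : opposite x z -> x.1 != Ss.
Proof. by case: x => -[]. Qed.

Lemma oppositeC x z : opposite x z = opposite z x.
Proof. by rewrite /opposite orbC [cd_letter x && _]andbC [ab_letter x && _]andbC. Qed.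

(** * Reduced stacks and the action of letters on normal forms *)

Section Push.
Variable T : eqType.
Implicit Types (x y : letter T) (l : word T).

(* Stacks hold reduced words in reverse order. *)
Definition push x l : word T :=
  if l is y :: l' then if y == linv x then l' else x :: l else [:: x].

Definition reduced l := sorted (fun x y => y != linv x) l.

Lemma push_reduced x l : reduced l -> reduced (push x l).
Proof.
case: l => [//|y l] /= yl; case: ifP => [_|/negbT xy]; first exact: path_sorted yl.
by rewrite /= xy.
Qed.

(** When [x] cancels the top, reducedness prevents the letter below from cancelling [linv x], so the
    top is put back. *)
Lemma pushK x l : reduced l -> push (linv x) (push x l) = l.
Proof.
case: l => [|y l] /= yl; first by rewrite linvK eqxx.
case: eqP yl => [->|_] yl; last by rewrite /= linvK eqxx.
by case: l yl => [|z l] /=; rewrite ?linvK //; case: eqP.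
Qed.

Lemma size_push x l : size (push x l) <= (size l).+1.
Proof. by case: l => [//|y l] /=; case: ifP => //= _; rewrite ltnW. Qed.

Lemma all_push (p : pred (letter T)) x l : p x -> all p l -> all p (push x l).
Proof.
by move=> px; case: l => [|y l] /=; rewrite ?px // => /andP[py pl]; case: ifP => _;
  rewrite /= ?px ?py.
Qed.

End Push.

(* (l, (g1, g2)): the heights and exponents of the successive conjugates of
   s^{+-1}, and the components in F(a, b) and F(c, d). *)
Definition state : Type := (word int * (wordS * wordS))%type.

Definition state_height (gs : wordS * wordS) : int := (wht gs.1 + wht gs.2)%R.

Definition actg (x : letterS) (gs : wordS * wordS) :=
  if ab_letter x then (push x gs.1, gs.2) else (gs.1, push x gs.2).

(** In the semidirect product, [s] read after an element of height [h] contributes the free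
    generator of index [h]. *)
Definition act (x : letterS) (st : state) : state :=
  if x.1 == Ss then (push (state_height st.2, x.2) st.1, st.2)
  else (st.1, actg x st.2).

Definition run (st : state) (w : wordS) : state :=
  foldl (fun st x => act x st) st w.

Definition state_reduced (st : state) : bool :=
  [&& reduced st.1, reduced st.2.1 & reduced st.2.2].

Lemma actgK x gs : reduced gs.1 -> reduced gs.2 -> actg (linv x) (actg x gs) = gs.
Proof.
case: gs => g1 g2 /= r1 r2; rewrite /actg -[ab_letter (linv x)]/(ab_letter x).
by case: (ab_letter x); rewrite /= pushK.
Qed.

Lemma actK x st : state_reduced st -> act (linv x) (act x st) = st.
Proof.
case: st => l gs /and3P[/= rl r1 r2]; rewrite /act /=.
case: (x.1 == Ss); rewrite /=; last by rewrite actgK.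
by rewrite -[(_, ~~ x.2)]/(linv (state_height gs, x.2)) pushK.
Qed.

Lemma act_reduced x st : state_reduced st -> state_reduced (act x st).
Proof.
case: st => l [g1 g2] /and3P[/= rl r1 r2]; rewrite /act /actg /state_reduced /=.
by case: ifP => _ /=; [|case: ifP => _ /=]; rewrite ?push_reduced ?rl ?r1 ?r2.
Qed.

Lemma run_reduced w st : state_reduced st -> state_reduced (run st w).
Proof. by elim: w st => [//|x w IH] st rst; apply/IH/act_reduced. Qed.

Lemma run_cat st u v : run st (u ++ v) = run (run st u) v.
Proof. exact: foldl_cat. Qed.

Lemma run_winv w st : state_reduced st -> run (run st w) (winv w) = st.
Proof.
elim: w st => [//|x w IH] st rst; rewrite winv_cons run_cat.
by rewrite [run st _]/= IH ?act_reduced //= actK.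
Qed.

Lemma ht_linv x : ht (linv x) = (- ht x)%R.
Proof. by case: x => -[] []. Qed.

Lemma wht_push x l : wht (push x l) = (ht x + wht l)%R.
Proof.
by case: l => [//|y l] /=; case: eqP => [->|//]; rewrite ht_linv; lia.
Qed.

Lemma state_height_actg x gs :
  state_height (actg x gs) = (ht x + state_height gs)%R.
Proof.
by rewrite /state_height /actg; case: ifP => _ /=; rewrite wht_push; lia.
Qed.

(** The result depends on [x] only through its height, so the conjugation relators act trivially. *)
Lemma run_wconj x st : x.1 != Ss -> state_reduced st ->
  run st (wconj [:: (Ss, false)] [:: x]) =
  (push (state_height st.2 - ht x, false)%R st.1, st.2).
Proof.
case: st => l gs /= /negbTE xs /and3P[/= rl r1 r2]; rewrite /act /= xs /=.
rewrite state_height_actg ht_linv -{2}(linvK x) actgK //.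
by congr (push (_, _) _, _); lia.
Qed.

Lemma run_rel r st : r \in rels stallings -> state_reduced st -> run st r = st.
Proof.
move=> rin rst.
have same_conj x y : x.1 != Ss -> y.1 != Ss -> ht x = ht y ->
    run st (wconj [:: (Ss, false)] [:: x] ++ winv (wconj [:: (Ss, false)] [:: y]))
    = st.
  move=> xs ys hxy; rewrite run_cat run_wconj // hxy -run_wconj //.
  exact: run_winv.
have commute x y : ab_letter x -> cd_letter y ->
    run st (wcomm [:: x] [:: y]) = st.
  case: st rst {same_conj} => l [g1 g2] /and3P[/= rl r1 r2] xab ycd.
  have xs : (x.1 == Ss) = false by case: x xab => -[].
  have ys : (y.1 == Ss) = false by case: y ycd => -[].
  have yab : ab_letter y = false by case: y ycd {ys} => -[].
  have lab z : ab_letter (linv z) = ab_letter z by [].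
  rewrite /act /= xs ys /= /actg !lab xab yab /=.
  by rewrite -{1}(linvK x) -{1}(linvK y) !pushK.
move: rin; rewrite !inE.
by do ![case/orP => [/eqP->|]] => [||||||||| /eqP->];
  first [exact: commute | exact: same_conj].
Qed.

(** Cancelling pairs and relators fix every reduced state, so the group acts on reduced states; a
    word representing the identity returns to the initial state. *)
Lemma run_group_eq u v st : group_eqS u v -> state_reduced st -> run st u = run st v.
Proof.
move=> uv; elim: uv st => {u v} [//|u v _ IH|u v w _ IH1 _ IH2|u u' v v' _ IH1 _ IH2
  |x|r rin] st rst.
- by rewrite IH.
- by rewrite IH1 ?IH2.
- by rewrite !run_cat IH1 // IH2 // run_reduced.
- exact: actK.
- exact: run_rel.
Qed.

(** * Normal form words and their linear length *)

Fixpoint stack_word (l : word int) (h : int) : wordS :=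
  if l is (k, e) :: l' then stack_word l' k ++ (Ss, e) :: zpow Sa (h - k)%R
  else zpow Sa h.

(** The traversal stops at the current height [h], where the next [s] is to be written, and
    [zpow Sa (- h)] brings it back to height 0. *)
Definition state_word (st : state) : wordS :=
  let h := state_height st.2 in
  stack_word st.1 h ++ zpow Sa (- h)%R ++ rev st.2.1 ++ rev st.2.2.

Definition state_bound N (st : state) : Prop :=
  [/\ all ab_letter st.2.1, all cd_letter st.2.2,
      size st.2.1 + size st.2.2 <= N
    & size (stack_word st.1 (state_height st.2)) <= N].

Lemma stack_word_size_height l h h' :
  size (stack_word l h') <= size (stack_word l h) + `|(h' - h)%R|%N.
Proof.
by case: l => [|[k e] l] /=; rewrite ?size_cat /= !size_zpow; lia.
Qed.

(** An [s] is written or cancelled at the current height without any power of [a] in between, and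
    any other letter changes the last power of [a] by at most one. *)
Lemma state_bound_act N x st : state_bound N st -> state_bound N.+1 (act x st).
Proof.
case: st => l [g1 g2] [/= g1ab g2cd hN hW]; rewrite /act /=.
case: ifP => [_|xs] /=.
  split=> //=; first by apply: leqW.
  case: l hW => [|y l] /=; first by rewrite size_cat /= !size_zpow; lia.
  case: eqP => [->|_] /=; first by rewrite size_cat /=; lia.
  by rewrite size_cat /= GRing.subrr /=; lia.
have hx := absz_ht x; rewrite /state_bound /= state_height_actg.
have := @stack_word_size_height l (state_height (g1, g2))
  (ht x + state_height (g1, g2))%R.
have s1 : size (push x g1 : wordS) <= (size g1).+1 by apply: size_push.
have s2 : size (push x g2 : wordS) <= (size g2).+1 by apply: size_push.
have xcd : ab_letter x || cd_letter x by case: x xs {hx s1 s2} => -[].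
rewrite /actg; case: ifP xcd => [xab _|_ /= xcd] hs /=;
  split; rewrite ?all_push //; try lia.
Qed.

(** * Updating the normal form in linear space *)

Section Bounded.
Variable K : nat.
Hypothesis commK :
  forall x z, opposite x z -> eq_withinS K [:: x; z] [:: z; x].
Hypothesis slideK : forall x z e, opposite x z -> x.2 = z.2 ->
  eq_withinS K [:: x; (Ss, e)] [:: z; (Ss, e); linv z; x].

Lemma commute_letter L x g : all (opposite x) g -> size g + K <= L ->
  eq_withinS L (x :: g) (g ++ [:: x]).
Proof.
elim: g L => [|y g IH] L /=; first by move=> *; apply: eq_within_refl.
case/andP=> oxy og hL.
apply: (@eq_within_trans stallings _ (y :: x :: g)).
  by apply: (@eq_within_at _ _ [::] g _ _ _ _ (commK oxy)) => //=; lia.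
by apply: (@eq_within_at _ _ [:: y] [::] _ _ _ _ (IH _ og (leqnn _)));
  rewrite ?cats0 //=; lia.
Qed.

Definition opposite_words g1 g2 := all (fun x => all (opposite x) g2) g1.

Lemma commute_words L g1 g2 : opposite_words g1 g2 ->
  size g1 + size g2 + K <= L -> eq_withinS L (g1 ++ g2) (g2 ++ g1).
Proof.
elim: g1 L => [|x g1 IH] L /=.
  by move=> *; rewrite cats0; apply: eq_within_refl.
case/andP=> ox og hL.
apply: (@eq_within_trans stallings _ (x :: g2 ++ g1)).
  by apply: (@eq_within_at _ _ [:: x] [::] _ _ _ _ (IH _ og (leqnn _)));
  rewrite ?cats0 //=; lia.
apply: (@eq_within_at _ _ [::] g1 _ _ _ _ (commute_letter ox (leqnn _))) => //=.
  by rewrite -catA.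
by lia.
Qed.

(** The letters of [g] cross [s] one at a time, the last one first. The powers of [z] collected on
    either side are never longer than [g], so the space stays linear. *)
Lemma slide_word L z e g : all (opposite (z, false)) g ->
  3 * size g + K + 6 <= L ->
  eq_withinS L (g ++ [:: (Ss, e)])
    (zpow z (wht g) ++ [:: (Ss, e)] ++ zpow z (- wht g)%R ++ g).
Proof.
set t := (Ss, e).
elim: g L => [|x g IH] L /=; first by move=> *; apply: eq_within_refl.
case/andP=> oxz og hL; have hg := absz_wht g; have hx := absz_ht x.
have xs : x.1 != Ss by move: oxz; rewrite oppositeC => /opposite_neq.
have oz (b : bool) : opposite x (z, b) by move: oxz; rewrite oppositeC.
have onseq (y : letterS) n b : opposite y (z, b) -> all (opposite y) (nseq n (z, b)).
  by move=> oy; rewrite all_nseq oy orbT.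
apply: (@eq_within_trans stallings _ (x :: zpow z (wht g) ++ t :: zpow z (- wht g)%R ++ g)).
  apply: (@eq_within_at _ _ [:: x] [::] _ _ _ _ (IH _ og (leqnn _)));
  rewrite ?cats0 //=; lia.
(* The letter [x] crosses the power of [z], slides past [t], crosses the inverse power, and the new
   powers of [z] are merged with the old ones. *)
apply: (@eq_within_trans stallings _ (zpow z (wht g) ++ x :: t :: zpow z (- wht g)%R ++ g)).
  apply: (@eq_within_at _ _ [::] (t :: zpow z (- wht g)%R ++ g) _ _ _ _
    (@commute_letter _ x (zpow z (wht g)) (onseq _ _ _ (oz _)) (leqnn _))) => //=.
    by rewrite -catA.
  by rewrite !size_cat !size_zpow; lia.
apply: (@eq_within_trans stallings _ (zpow z (wht g) ++ zpow z (ht x) ++ t ::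
   zpow z (- ht x)%R ++ x :: zpow z (- wht g)%R ++ g)).
  rewrite zpow_ht // zpow_htN //.
  apply: (@eq_within_at _ _ (zpow z (wht g)) (zpow z (- wht g)%R ++ g) _ _ _ _
    (@slideK x (z, x.2) e (oz _) erefl)) => //=.
  by rewrite !size_cat !size_zpow; lia.
apply: (@eq_within_trans stallings _ (zpow z (wht g) ++ zpow z (ht x) ++ t ::
   zpow z (- ht x)%R ++ zpow z (- wht g)%R ++ x :: g)).
  apply: (@eq_within_at _ _ (zpow z (wht g) ++ zpow z (ht x) ++ t :: zpow z (- ht x)%R)
    g _ _ _ _
    (@commute_letter _ x (zpow z (- wht g)%R) (onseq _ _ _ (oz _)) (leqnn _))).
  - by rewrite /= -?catA /= -?catA.
  - by rewrite /= -?catA /= -?catA.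
  - by rewrite !size_cat /= !size_zpow; lia.
apply: (@eq_within_trans stallings _ (zpow z (ht x + wht g)%R ++ t ::
   zpow z (- ht x)%R ++ zpow z (- wht g)%R ++ x :: g)).
  rewrite [(ht x + _)%R]GRing.addrC.
  apply: (@eq_within_at _ _ [::] (t :: zpow z (- ht x)%R ++ zpow z (- wht g)%R ++ x :: g)
    _ _ _ _ (@zpowD _ z (wht g) (ht x) (leqnn _))); rewrite /= -?catA //.
  by rewrite !size_cat /= !size_zpow; lia.
have -> : (- (ht x + wht g) = - ht x + - wht g)%R by lia.
apply: (@eq_within_at _ _ (zpow z (ht x + wht g)%R ++ [:: t]) (x :: g)
    _ _ _ _ (@zpowD _ z (- ht x)%R (- wht g)%R (leqnn _))) => //=.
- by rewrite -!catA.
- by rewrite -!catA.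
- by rewrite !size_cat /= !size_zpow; lia.
Qed.

(** Slide [c^h] across [s] using powers of [a], then cancel [c^h c^-h]. *)
Lemma zpow_swap L e h : 6 * `|h|%N + K + 6 <= L ->
  eq_withinS L (zpow Sc h ++ [:: (Ss, e)] ++ zpow Sc (- h)%R)
               (zpow Sa h ++ [:: (Ss, e)] ++ zpow Sa (- h)%R).
Proof.
move=> hL; have oc : all (opposite (Sa, false)) (zpow Sc h).
  by rewrite all_nseq orbT.
have := @slide_word _ Sa e _ oc (leqnn _); rewrite wht_zpow // size_zpow => H.
apply: (@eq_within_trans stallings _
  (zpow Sa h ++ [:: (Ss, e)] ++ zpow Sa (- h)%R ++ zpow Sc h ++ zpow Sc (- h)%R)).
  apply: (@eq_within_at _ _ [::] (zpow Sc (- h)%R) _ _ _ _ H); rewrite -?catA //=.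
  by rewrite size_zpow; lia.
apply: (@eq_within_at _ _ (zpow Sa h ++ [:: (Ss, e)] ++ zpow Sa (- h)%R) [::]
  _ _ _ _ (@zpowD _ Sc h (- h)%R (leqnn _))); rewrite -?catA ?cats0 //.
  by rewrite GRing.subrr cats0.
by rewrite !size_cat /= !size_zpow; lia.
Qed.

(** [g2] slides using powers of [a] and [g1] using powers of [c], with exchanges of the two kinds of
    conjugating powers in between and at the end. *)
Lemma slide_both L e g1 g2 h : all ab_letter g1 -> all cd_letter g2 ->
  h = (wht g1 + wht g2)%R -> 10 * (size g1 + size g2) + K + 10 <= L ->
  eq_withinS L (g1 ++ g2 ++ [:: (Ss, e)])
    (zpow Sa h ++ [:: (Ss, e)] ++ zpow Sa (- h)%R ++ g1 ++ g2).
Proof.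
move=> g1ab g2cd hE hL; set t := [:: (Ss, e)].
have h1 := absz_wht g1; have h2 := absz_wht g2.
have oa : all (opposite (Sa, false)) g2.
  by apply: sub_all g2cd => x; rewrite /opposite /= => ->.
have oc : all (opposite (Sc, false)) g1.
  by apply: sub_all g1ab => x; rewrite /opposite /= => ->.
have og1c k : opposite_words g1 (zpow Sc k).
  by apply: sub_all g1ab => x xab; rewrite all_nseq /opposite xab orbT.
set k1 := wht g1 in hE h1 *; set k2 := wht g2 in hE h2 *.
apply: (@eq_within_trans stallings _ (g1 ++ zpow Sa k2 ++ t ++ zpow Sa (- k2)%R ++ g2)).
  apply: (@eq_within_at _ _ g1 [::] _ _ _ _ (@slide_word _ Sa e _ oa (leqnn _)));
    rewrite ?cats0 //=; lia.
(* The powers of [a] need not commute with [g1], so they are exchanged for powers of [c], which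
   do. *)
apply: (@eq_within_trans stallings _ (g1 ++ zpow Sc k2 ++ t ++ zpow Sc (- k2)%R ++ g2)).
  apply: (@eq_within_at _ _ g1 g2 _ _ _ _
    (eq_within_sym (@zpow_swap _ e k2 (leqnn _)))); rewrite -?catA //=; lia.
apply: (@eq_within_trans stallings _ (zpow Sc k2 ++ g1 ++ t ++ zpow Sc (- k2)%R ++ g2)).
  apply: (@eq_within_at _ _ [::] (t ++ zpow Sc (- k2)%R ++ g2) _ _ _ _
    (@commute_words _ _ _ (og1c k2) (leqnn _))); rewrite -?catA //=.
  by rewrite !size_cat !size_zpow; lia.
apply: (@eq_within_trans stallings _
  (zpow Sc k2 ++ zpow Sc k1 ++ t ++ zpow Sc (- k1)%R ++ g1 ++ zpow Sc (- k2)%R ++ g2)).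
  apply: (@eq_within_at _ _ (zpow Sc k2) (zpow Sc (- k2)%R ++ g2) _ _ _ _
    (@slide_word _ Sc e _ oc (leqnn _))); rewrite -?catA //=.
  by rewrite !size_cat !size_zpow; lia.
apply: (@eq_within_trans stallings _
  (zpow Sc k2 ++ zpow Sc k1 ++ t ++ zpow Sc (- k1)%R ++ zpow Sc (- k2)%R ++ g1 ++ g2)).
  apply: (@eq_within_at _ _ (zpow Sc k2 ++ zpow Sc k1 ++ t ++ zpow Sc (- k1)%R) g2
    _ _ _ _ (@commute_words _ _ _ (og1c (- k2)%R) (leqnn _))); rewrite -?catA //=.
  by rewrite !size_cat /= !size_zpow; lia.
apply: (@eq_within_trans stallings _
  (zpow Sc h ++ t ++ zpow Sc (- k1)%R ++ zpow Sc (- k2)%R ++ g1 ++ g2)).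
  have -> : h = (k2 + k1)%R by lia.
  apply: (@eq_within_at _ _ [::] (t ++ zpow Sc (- k1)%R ++ zpow Sc (- k2)%R ++ g1 ++ g2)
    _ _ _ _ (@zpowD _ Sc k2 k1 (leqnn _))); rewrite -?catA //=.
  by rewrite !size_cat !size_zpow; lia.
apply: (@eq_within_trans stallings _ (zpow Sc h ++ t ++ zpow Sc (- h)%R ++ g1 ++ g2)).
  have -> : (- h = - k1 + - k2)%R by lia.
  apply: (@eq_within_at _ _ (zpow Sc h ++ t) (g1 ++ g2)
    _ _ _ _ (@zpowD _ Sc (- k1)%R (- k2)%R (leqnn _))); rewrite -?catA //=.
  by rewrite !size_cat /= !size_zpow; lia.
apply: (@eq_within_at _ _ [::] (g1 ++ g2) _ _ _ _
  (@zpow_swap _ e h (leqnn _))); rewrite -?catA //=.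
by rewrite !size_cat; lia.
Qed.

Lemma push_within L (l : wordS) x : size l < L ->
  eq_withinS L (rev l ++ [:: x]) (rev (push x l)).
Proof.
case: l => [|y l] /= hL; first exact: eq_within_refl.
case: eqP => [->|_]; last first.
  by rewrite [in X in _ X](rev_cons x) cats1; apply: eq_within_refl.
have := @eq_within_cancel stallings 2 (linv x) isT; rewrite linvK => cx.
apply: (@eq_within_at _ _ (rev l) [::] _ _ _ _ cx); rewrite ?cats0 //=.
  by rewrite rev_cons -cats1 -catA.
by rewrite size_rev; lia.
Qed.

Lemma zpow_cancel L z h k : `|h|%N + `|k|%N <= L -> (h + k = 0)%R ->
  eq_withinS L (zpow z h ++ zpow z k) [::].
Proof. by move=> hL hk; have := @zpowD L z h k hL; rewrite hk. Qed.

(** The final powers merge as [a^(h-k) a^-h = a^-k], so the right-hand side is independent of [h];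
    two end heights can be compared through it. *)
Lemma stack_word_end L l h : size (stack_word l h) + `|h|%N <= L ->
  eq_withinS L (stack_word l h ++ zpow Sa (- h)%R)
    (if l is (k, e) :: l' then stack_word l' k ++ (Ss, e) :: zpow Sa (- k)%R
     else [::]).
Proof.
case: l => [|[k e] l] /=; rewrite ?size_cat /= size_zpow => hL.
  by apply: zpow_cancel; lia.
have := @zpowD (`|(h - k)%R|%N + `|(- h)%R|%N) Sa (h - k)%R (- h)%R (leqnn _).
have -> : (h - k + - h = - k)%R by lia.
move=> H; apply: (@eq_within_at _ _ (stack_word l k ++ [:: (Ss, e)]) [::] _ _ _ _ H);
  rewrite ?cats0 -?catA //=.
by rewrite size_cat /=; lia.
Qed.

Lemma stack_word_height L l h h' :
  size (stack_word l h) + `|h|%N <= L -> size (stack_word l h') + `|h'|%N <= L ->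
  eq_withinS L (stack_word l h ++ zpow Sa (- h)%R)
    (stack_word l h' ++ zpow Sa (- h')%R).
Proof.
move=> /stack_word_end H /stack_word_end H'.
exact: (@eq_within_trans stallings _ _ _ _ H (eq_within_sym H')).
Qed.

Lemma stack_word_push L l h e : size (stack_word l h) < L ->
  eq_withinS L (stack_word l h ++ [:: (Ss, e)]) (stack_word (push (h, e) l) h).
Proof.
have z0 : zpow Sa (h - h)%R = [::] by rewrite GRing.subrr.
case: l => [|y l] hL; first by rewrite /= z0; apply: eq_within_refl.
rewrite [push _ _]/=; case: eqP => [Ey|_]; last first.
  by rewrite /= z0; apply: eq_within_refl.
move: hL; rewrite Ey /= z0 size_cat /= => hL.
have := @eq_within_cancel stallings 2 (Ss, ~~ e) isT.
rewrite /linv /= negbK => cx.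
apply: (@eq_within_at _ _ (stack_word l h) [::] _ _ _ _ cx);
  rewrite ?cats0 -?catA //=.
by lia.
Qed.

(** An [s] moves left across both free components to join the traversal. A letter of [F(a,b)] first
    commutes past the [F(c,d)] component, a letter of [F(c,d)] is already in place, and in both
    cases the end height of the traversal is then adjusted. *)
Lemma act_within N L x st : state_bound N st -> 30 * N + K + 30 <= L ->
  eq_withinS L (state_word st ++ [:: x]) (state_word (act x st)).
Proof.
case: st => l [g1 g2] [/= g1ab g2cd hN hW] hL.
rewrite /state_word /act /=.
set h := state_height (g1, g2) in hW *.
have hdef : h = (wht g1 + wht g2)%R by [].
have hh : `|h|%N <= N.
  by have := absz_wht g1; have := absz_wht g2; lia.
have r1ab : all ab_letter (rev g1) by rewrite all_rev.
have r2cd : all cd_letter (rev g2) by rewrite all_rev.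
have hx := absz_ht x.
have hch := @stack_word_size_height l h (ht x + h)%R.
case: ifP => [/eqP xs|_] /=.
  case: x xs {hx hch} => _ e /= ->; rewrite -/h.
  (* The power [a^h] produced here cancels the return [a^-h] of the traversal, leaving [s] at height
     [h]. *)
  have sl : eq_withinS (10 * N + K + 10) (rev g1 ++ rev g2 ++ [:: (Ss, e)])
    (zpow Sa h ++ [:: (Ss, e)] ++ zpow Sa (- h)%R ++ rev g1 ++ rev g2).
    by apply: slide_both; rewrite ?wht_rev // !size_rev; lia.
  apply: (@eq_within_trans stallings _ (stack_word l h ++ zpow Sa (- h)%R ++
      zpow Sa h ++ [:: (Ss, e)] ++ zpow Sa (- h)%R ++ rev g1 ++ rev g2)).
    apply: (@eq_within_at _ _ (stack_word l h ++ zpow Sa (- h)%R) [::] _ _ _ _ sl);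
      rewrite ?cats0 -?catA //.
    by rewrite size_cat size_zpow /=; lia.
  apply: (@eq_within_trans stallings _ (stack_word l h ++
      [:: (Ss, e)] ++ zpow Sa (- h)%R ++ rev g1 ++ rev g2)).
    apply: (@eq_within_at _ _ (stack_word l h)
      ([:: (Ss, e)] ++ zpow Sa (- h)%R ++ rev g1 ++ rev g2) _ _ _ _
      (@zpow_cancel _ Sa (- h)%R h (leqnn _) _)); rewrite -?catA //; first by lia.
    by rewrite !size_cat !size_rev size_zpow /=; lia.
  apply: (@eq_within_at _ _ [::] (zpow Sa (- h)%R ++ rev g1 ++ rev g2) _ _ _ _
      (@stack_word_push _ l h e (ltnSn _))); rewrite -?catA //.
  by rewrite !size_cat !size_rev size_zpow /=; lia.
rewrite state_height_actg -/h /actg; case: ifP => xab /=.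
  have ox : all (opposite x) (rev g2).
    by apply: sub_all r2cd => y ycd; rewrite /opposite xab ycd.
  apply: (@eq_within_trans stallings _ (stack_word l h ++ zpow Sa (- h)%R ++
      (rev g1 ++ [:: x]) ++ rev g2)).
    apply: (@eq_within_at _ _ (stack_word l h ++ zpow Sa (- h)%R ++ rev g1) [::] _ _
      _ _ (eq_within_sym (commute_letter ox (leqnn _))));
      rewrite ?cats0 -?catA //.
    by rewrite !size_cat !size_rev size_zpow /=; lia.
  apply: (@eq_within_trans stallings _ (stack_word l h ++ zpow Sa (- h)%R ++
      rev (push x g1) ++ rev g2)).
    apply: (@eq_within_at _ _ (stack_word l h ++ zpow Sa (- h)%R) (rev g2) _ _
      _ _ (@push_within _ g1 x (ltnSn _))); rewrite -?catA //.
    by rewrite !size_cat !size_rev size_zpow /=; lia.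
  (* Traversal and height are each at most [N] before and [N + 1] after the step. *)
  apply: (@eq_within_at (2 * N + 4) _ [::] (rev (push x g1) ++ rev g2) _ _ _ _
    (@stack_word_height _ l h (ht x + h)%R _ _)); rewrite -?catA //; try lia.
  have : size (push x g1 : wordS) <= (size g1).+1 by apply: size_push.
  by rewrite !size_cat !size_rev /=; lia.
apply: (@eq_within_trans stallings _ (stack_word l h ++ zpow Sa (- h)%R ++
    rev g1 ++ rev (push x g2))).
  apply: (@eq_within_at _ _ (stack_word l h ++ zpow Sa (- h)%R ++ rev g1) [::] _ _
    _ _ (@push_within _ g2 x (ltnSn _))); rewrite ?cats0 -?catA //.
  by rewrite !size_cat !size_rev size_zpow /=; lia.
apply: (@eq_within_at (2 * N + 4) _ [::] (rev g1 ++ rev (push x g2)) _ _ _ _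
  (@stack_word_height _ l h (ht x + h)%R _ _)); rewrite -?catA //; try lia.
have : size (push x g2 : wordS) <= (size g2).+1 by apply: size_push.
  by rewrite !size_cat !size_rev /=; lia.
Qed.

(** Reading a letter raises [N] by one and shortens [v] by one, so [N + size v] is invariant; 31
    covers the factor 30 of one step and the unread suffix. *)
Lemma run_within L N v st : state_bound N st -> 31 * (N + size v) + K + 30 <= L ->
  eq_withinS L (state_word st ++ v) (state_word (run st v)).
Proof.
elim: v N st => [|x v IH] N st bst /= hL.
  by rewrite cats0; apply: eq_within_refl.
apply: (@eq_within_trans stallings _ (state_word (act x st) ++ v)).
  apply: (@eq_within_at _ _ [::] v _ _ _ _ (act_within x bst (leqnn _)));
    rewrite -?catA //=; lia.
by apply: IH (state_bound_act x bst) _; lia.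
Qed.

End Bounded.

(** * Linear bounds for Stallings' group *)

Lemma stallings_eq_within : exists C, forall n (w : wordS), size w <= n ->
  represents_one (P := stallings) w -> eq_withinS (C * n + C) w [::].
Proof.
have [K1 comm] : exists K, forall p : letterS * letterS, opposite p.1 p.2 ->
    eq_withinS K [:: p.1; p.2] [:: p.2; p.1].
  apply: uniform_bound => [p K M KM H /H|[x z]]; first exact: eq_within_leq.
  case: (boolP (opposite x z)) => [oxz|_]; last by exists 0.
  by have [L HL] := group_eq_within (group_eq_commute oxz); exists L.
have [K2 slide] : exists K, forall p : letterS * letterS * bool,
    opposite p.1.1 p.1.2 -> p.1.1.2 = p.1.2.2 ->
    eq_withinS K [:: p.1.1; (Ss, p.2)] [:: p.1.2; (Ss, p.2); linv p.1.2; p.1.1].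
  apply: uniform_bound => [p K M KM H o e|[[x z] e]].
    exact: eq_within_leq KM (H o e).
  case: (boolP (opposite x z && (x.2 == z.2))) => [/andP[oxz /eqP exz]|/negP no].
    by have [L HL] := group_eq_within (group_eq_slide e oxz exz); exists L.
  by exists 0 => /= o e'; case: no; rewrite o e' eqxx.
exists (K1 + K2 + 31) => n w wn w1.
have comm' x z : opposite x z -> eq_withinS (K1 + K2) [:: x; z] [:: z; x].
  by move=> o; apply: eq_within_leq (comm (x, z) o); lia.
have slide' x z e : opposite x z -> x.2 = z.2 ->
    eq_withinS (K1 + K2) [:: x; (Ss, e)] [:: z; (Ss, e); linv z; x].
  by move=> o xz; apply: eq_within_leq (slide (x, z, e) o xz); lia.
(* The initial state has the empty word as normal form and [N = 0]; since [w] represents the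
   identity, the run ends there too. *)
have := @run_within _ comm' slide' ((K1 + K2 + 31) * n + (K1 + K2 + 31)) 0 w
  ([::], ([::], [::])).
by rewrite (run_group_eq w1) //; apply=> //; nia.
Qed.

(** The lower bound is automatic, as [preceq] allows an additive linear term. *)
Lemma linear_of_le f C : (forall n, f n <= C * n + C) -> linear f.
Proof.
move=> fC; split; exists C.+1; split=> // n; last by lia.
by apply: leq_trans (fC n) _; lia.
Qed.

Theorem corollary1p4 :
  (exists f : nat -> nat, isodiametric_function stallings f /\ linear f) /\
  linear (FL stallings).
Proof.
have [C hC] := stallings_eq_within.
have [K hK] := collapses_of_eq_within stallings_expands.
have collapse n (w : wordS) : size w <= n -> represents_one (P := stallings) w ->
    collapses (P := stallings) ((C + K + 1) * n + (C + K + 1)) w [::].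
  (* The constant is raised from [C] to [C + 1] so that the bound also dominates the length of [w]
     itself. *)
  move=> wn w1; have wC : size w <= (C + 1) * n + (C + 1) by nia.
  have /(hK _ _ wC) : eq_withinS ((C + 1) * n + (C + 1)) w [::].
    by apply: eq_within_leq (hC _ _ wn w1); nia.
  by apply: collapses_leq; nia.
split.
  (* The doubling turns the distance to the base vertex into a diameter. *)
  exists (fun n => ((C + K + 1) * n + (C + K + 1)).*2); split.
    move=> n w wn w1.
    exact: (@diagram_collapses stallings _ (Sa, false) w (collapse _ _ wn w1)).
  by apply: (@linear_of_le _ (2 * (C + K + 1))) => n; nia.
apply: (@linear_of_le _ (C + K + 1)) => n; apply/bigmax_leqP => k _.
apply/bigmax_leqP => w /boolp.asboolP w1.
apply/FL_word_collapses/collapse => //.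
by rewrite size_tuple -ltnS.
Qed.
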